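(* Let $a,b,c,d,x_0,x_1$ be real numbers such that $a,c<0$, $b,d>0$ and $x_0,x_1>\sqrt3$. Then the piecewise system $$\begin{cases}\dot z=(a+ib)(z-i+x_1), & z\in\Sigma_+=\{\Im(z)>1\},\\ \dot z=iz^3, & z\in\Sigma_c=\{|\Im(z)|<1\},\\ \dot z=(c+id)(z+i-x_0), & z\in\Sigma_-=\{\Im(z)<-1\},\end{cases}$$ has a limit cycle.
   Context: Planar piecewise-smooth system ($z=x+iy\in\mathbb C\cong\mathbb R^2$) with discontinuity lines $\Im(z)=\pm1$, on which the dynamics follows Filippov's convention (where both adjacent vector fields cross the line in the same direction, trajectories are obtained by concatenation). A limit cycle is an isolated periodic orbit. *)

(* Defs.v *)
From HB Require Import structures.
From mathcomp Require Import all_boot all_order all_algebra.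
From mathcomp Require Import complex.
From mathcomp Require Import all_classical all_reals all_analysis.
Set Implicit Arguments.
Unset Strict Implicit.
Unset Printing Implicit Defensive.
Import Order.TTheory GRing.Theory Num.Theory.
Import numFieldNormedType.Exports.
Local Open Scope classical_set_scope.
Local Open Scope ring_scope.
Local Open Scope complex_scope.

Definition segment (R : realType) (u v : R[i]) : set R[i] :=
  [set l%:C * u + (1 - l)%:C * v | l in `[0, 1]%classic].

(* Filippov's set-valued field of the system with right-hand side Xp on
   Im z > 1, Xc on |Im z| < 1 and Xm on Im z < -1.  As Xp, Xc, Xm are meant to
   be continuous on the whole plane, the closed convex hull of the limit values
   at a point of a discontinuity line is the segment joining the values of the
   two adjacent fields. *)
Definition filippov_strip (R : realType) (Xp Xc Xm : R[i] -> R[i]) (z : R[i])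
    : set R[i] :=
  if 1 < complex.Im z then [set Xp z]
  else if complex.Im z == 1 then segment (Xp z) (Xc z)
  else if -1 < complex.Im z then [set Xc z]
  else if complex.Im z == -1 then segment (Xc z) (Xm z)
  else [set Xm z].

Definition absolutely_continuous (R : realType) (p q : R) (f : R -> R) : Prop :=
  forall e : R, 0 < e -> exists2 r : R, 0 < r &
    forall (n : nat) (u v : 'I_n -> R),
      (forall i, [/\ p <= u i, u i <= v i & v i <= q]) ->
      trivIset setT (fun i => `]u i, v i[%classic) ->
      \sum_i (v i - u i) < r ->
      \sum_i `|f (v i) - f (u i)| < e.

(* Solution on the whole line of the differential inclusion z' \in F z. *)
Definition filippov_solution (R : realType) (F : R[i] -> set R[i])
    (g : R -> R[i]) : Prop :=
  [/\ forall p q : R, absolutely_continuous p q (fun t => complex.Re (g t)),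
      forall p q : R, absolutely_continuous p q (fun t => complex.Im (g t)) &
      {ae (@lebesgue_measure R), forall t : R, exists2 v : R[i], F (g t) v &
        is_derive t 1 (fun s => complex.Re (g s)) (complex.Re v) /\
        is_derive t 1 (fun s => complex.Im (g s)) (complex.Im v)}].

Definition periodic_orbit (R : realType) (F : R[i] -> set R[i])
    (G : set R[i]) : Prop :=
  exists g : R -> R[i],
    [/\ filippov_solution F g,
        exists2 T : R, 0 < T & forall t, g (t + T) = g t,
        exists t s : R, g t != g s &
        G = range g].

(* A periodic orbit is compact, so its neighbourhoods contain the uniform ones;
   isolation excludes every other periodic orbit that meets the neighbourhood,
   not only those contained in it. *)
Definition limit_cycle (R : realType) (F : R[i] -> set R[i])
    (G : set R[i]) : Prop :=
  periodic_orbit F G /\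
  exists2 e : R, 0 < e &
    forall G' : set R[i], periodic_orbit F G' ->
      (exists z w : R[i], [/\ G z, G' w & `|w - z| < e%:C]) -> G' = G.

(* Main.v *)
(* Every level curve of Re (1 / z ^ 2) is invariant under z' = i z ^ 3, so the
   central flow sends x - i to x + i and - x + i to - x - i when x > sqrt 3; the
   upper focus sends x + i to - (x1 + (x + x1) exp (a pi / b)) + i, and z -> - z
   exchanges the two foci.  The first return map to {x + i | x > sqrt 3} is thus
   an affine contraction, whose fixed point lies on a periodic orbit G.
   Only crossing points are met along these arcs, where Filippov solutions are
   determined forward in time by their initial point: an absolutely continuous
   solution leaves a crossing point upwards or downwards at once, and then
   coincides with the classical trajectory.  Hence a periodic orbit that comes
   near G meets the section, contains all iterates of the return map, hence by
   compactness its fixed point, and is therefore G. *)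
Require Import Defs.
From HB Require Import structures.
From mathcomp Require Import all_boot all_order all_algebra.
From mathcomp Require Import complex.
From mathcomp Require Import all_classical all_reals all_analysis.
From mathcomp Require Import ring lra.
Set Implicit Arguments.
Unset Strict Implicit.
Unset Printing Implicit Defensive.
Import Order.TTheory GRing.Theory Num.Theory.
Import numFieldNormedType.Exports.
Local Open Scope classical_set_scope.
Local Open Scope ring_scope.
Local Open Scope complex_scope.

(** * Absolutely continuous functions *)

(** Solutions are only absolutely continuous and obey the inclusion almost everywhere, so a
    competing periodic orbit could a priori slide or split on the lines. The proof therefore works
    with forced arcs: an explicit curve together with the fact that every Filippov solution through
    its initial point follows it. No existence theorem for differential equations enters, as both
    flows are explicit: the foci give logarithmic spirals, and [(1 / z ^ 2)' = - 2 i] along the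
    central field. The number sqrt 3 is the abscissa where the central field is tangent to the
    lines. On [Im z = 1] both fields point up for [x > sqrt 3] and both point down for [x < - x1],
    because [x1 > sqrt 3]; between [- x1] and [- sqrt 3] the line is escaping, and the arc of the
    upper focus lands to the left of that interval. The return map has slope
    [exp (a pi / b + c pi / d)], below 1 by the signs of the parameters. The main tool for
    absolutely continuous functions is a mean value inequality, drawn from Cousin's lemma. *)

Lemma real_induction (R : realType) (p q : R) (P : R -> Prop) :
  P p ->
  (forall t, p < t <= q -> (forall s, p <= s < t -> P s) -> P t) ->
  (forall t, p <= t < q -> (forall s, p <= s <= t -> P s) ->
    exists2 u, t < u & forall s, t < s <= u -> s <= q -> P s) ->
  forall t, p <= t <= q -> P t.
Proof.
move=> Pp Plim Pnext t0 /andP[pt0 t0q].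
have pq := le_trans pt0 t0q.
pose E := [set t | p <= t <= q /\ forall s, p <= s <= t -> P s].
have Ep : E p.
  split; first by rewrite lexx.
  by move=> s /andP[ps sp]; have -> : s = p by apply/le_anti/andP.
have E0 : E !=set0 by exists p.
have ubE : has_ubound E by exists q => t [/andP[]].
(* [P] passes to [S] by the limit hypothesis, and [S < q] is impossible because the last hypothesis
   would push [E] beyond its supremum. *)
pose S := sup E.
have pS : p <= S by exact: (ub_le_sup ubE Ep).
have Sq : S <= q by apply: ge_sup => // t [/andP[]].
have PltS s : p <= s < S -> P s.
  move=> /andP[ps sS].
  have [t [_ Pt] st] := sup_gt E0 sS.
  by apply: Pt; rewrite ps ltW.
have PS : P S.
  move: pS; rewrite le_eqVlt => /predU1P[<-//|pS'].
  by apply: Plim PltS; rewrite pS'.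
have PleS s : p <= s <= S -> P s.
  move=> /andP[ps]; rewrite le_eqVlt => /predU1P[->//|sS].
  by apply: PltS; rewrite ps.
suff SE : S = q by apply: PleS; rewrite pt0 SE.
apply/eqP; rewrite eq_le Sq /= leNgt; apply/negP => Sltq.
have [u Su Pu] := Pnext S (ltac:(lra)) PleS.
have : E (Num.min u q).
  split; first by rewrite ge_min lexx orbT andbT le_min pq ltW ?(le_lt_trans pS).
  move=> s /andP[ps]; rewrite le_min => /andP[su sq].
  have [sS|Ss] := leP s S; first by apply: PleS; rewrite ps.
  by apply: Pu => //; rewrite Ss.
move/(ub_le_sup ubE).
by rewrite leNgt lt_min Su Sltq.
Qed.

(** Cousin's lemma without explicit partitions: [Q] is any property of intervals that survives
    concatenation, and [r] is the gauge at the tag [x]. Real induction on the right endpoint proves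
    it. *)
Lemma cousin (R : realType) (p q : R) (Q : R -> R -> Prop) : p < q ->
  (forall u v w, p <= u -> u < v -> v < w -> w <= q ->
    Q u v -> Q v w -> Q u w) ->
  (forall x, p <= x <= q -> exists2 r, 0 < r & forall u v,
    [/\ p <= u, u <= x, x <= v & v <= q] -> u < v -> x - r < u -> v < x + r ->
    Q u v) ->
  Q p q.
Proof.
move=> pq Qcat Qtag.
suff : forall t, p <= t <= q -> p < t -> Q p t by apply; rewrite ?lexx ?ltW.
apply: real_induction => [|t /andP[pt tq] IH _|t /andP[pt tq] IH].
- by rewrite ltxx.
- have [r r0 Qr] := Qtag t (ltac:(lra)).
  have [sp|ps] := leP (t - r / 2) p.
    apply: Qr => //; [by rewrite lexx; split => //; exact: ltW|lra..].
  have Qps : Q p (t - r / 2) by apply: IH => //; apply/andP; split; lra.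
  apply: Qcat Qps _ => //; try lra.
  by apply: Qr; [split|..]; lra.
- have [r r0 Qr] := Qtag t (ltac:(lra)).
  exists (t + r / 2); first lra.
  move=> s /andP[ts sr] sq ps.
  have Qts : Q t s by apply: Qr; [split|..]; lra.
  move: pt; rewrite le_eqVlt => /predU1P[->//|pt].
  by apply: Qcat (IH t _ pt) Qts => //; rewrite lexx ltW.
Qed.

Lemma is_derive_approx (R : realType) (f : R -> R) (x df : R) :
  is_derive x 1 f df -> forall e : R, 0 < e -> exists2 r, 0 < r &
    forall y, `|y - x| < r -> `|f y - f x - df * (y - x)| <= e * `|y - x|.
Proof.
move=> [cvf <-] e e0.
have : (fun h => h^-1 *: ((f \o shift x) (h *: 1) - f x)) @ 0^' --> 'D_1 f x
  by exact: cvf.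
move=> /cvgrPdist_le /(_ e e0)[r /= r0 H]; exists r => // y yxr.
have [->|yx] := eqVneq y x; first by rewrite !subrr mulr0 subrr normr0 mulr0.
have yx0 : y - x != 0 by rewrite subr_eq0.
have := H (y - x); rewrite /ball/= sub0r normrN => /(_ yxr yx0).
rewrite -[_%:A]/((y - x) * 1) mulr1 subrK distrC.
rewrite -(ler_pM2r (x := `|y - x|)) ?normr_gt0// -normrM mulrBl.
by rewrite -[_ *: _]/(_ * _) mulrAC mulVf// mul1r.
Qed.

Lemma lebesgue_measure_splitI (R : realType) (U : set R) (u v w : R) :
  open U -> u <= v -> v <= w ->
  (lebesgue_measure (U `&` `]u, v]) + lebesgue_measure (U `&` `]v, w]) =
   lebesgue_measure (U `&` `]u, w]))%E.
Proof.
move=> oU uv vw.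
have mU := measurable_realfun.open_measurable oU.
rewrite -measureU; [|exact: measurableI|exact: measurableI|].
  rewrite -setIUr; congr (lebesgue_measure (_ `&` _)).
  apply/seteqP; split=> x /=; rewrite !in_itv/=.
    by move=> [] /andP[]; lra.
  by move=> /andP[ux xw]; case: (leP x v); [left|right]; lra.
apply/seteqP; split=> x //= [[_ +] [_]]; rewrite !in_itv/=; lra.
Qed.

(** Intervals extracted from a Cousin partition arrive as concatenated lists, ordered from left to
    right; the order yields the disjointness that absolute continuity asks for. *)
Lemma absolutely_continuous_seq (R : realType) (p q : R) (f : R -> R) :
  absolutely_continuous p q f -> forall e : R, 0 < e -> exists2 r : R, 0 < r &
    forall s : seq (R * R),
      all (fun x => [&& p <= x.1, x.1 <= x.2 & x.2 <= q]) s ->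
      pairwise (fun x y => x.2 <= y.1) s ->
      \sum_(x <- s) (x.2 - x.1) < r ->
      \sum_(x <- s) `|f x.2 - f x.1| < e.
Proof.
move=> acf e e0; have [r r0 H] := acf e e0; exists r => // s sall spair.
rewrite !(big_nth (0, 0)) !big_mkord => sr.
apply: (H (size s) (fun i => (nth (0, 0) s i).1) (fun i => (nth (0, 0) s i).2)) => //.
  by move=> i; have /and3P[] := allP sall _ (mem_nth (0, 0) (ltn_ord i)).
move=> i j _ _ [z [/=]]; rewrite !in_itv/= => /andP[zi iz] /andP[zj jz].
have /pairwiseP := spair => /(_ (0, 0)) sp.
apply: ord_inj; case: (ltngtP i j) => [ij|ji|//].
  have /= le_ij := sp i j (ltn_ord i) (ltn_ord j) ij.
  by have := lt_trans (lt_le_trans iz le_ij) zj; rewrite ltxx.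
have /= le_ji := sp j i (ltn_ord j) (ltn_ord i) ji.
by have := lt_trans (lt_le_trans jz le_ji) zi; rewrite ltxx.
Qed.

(* The tags at which the derivative is not controlled lie in an open set of
   small measure, so absolute continuity bounds the total increment of f over
   the corresponding intervals of a Cousin partition. *)
Lemma absolutely_continuous_nonincreasing (R : realType) (p q : R) (f : R -> R) :
  p <= q -> absolutely_continuous p q f ->
  {ae (@lebesgue_measure R), forall t, p < t < q ->
    exists2 df, is_derive t 1 f df & df <= 0} ->
  f q <= f p.
Proof.
rewrite le_eqVlt => /predU1P[->//|pq] acf [N [mN N0 subN]].
suff H (e : R) : 0 < e -> f q - f p <= e * (q - p) + e.
  rewrite -subr_le0; apply/ler_addgt0Pl => e e0.
  have qp : 0 < q - p + 1 by lra.
  have := H (e / (q - p + 1)) (divr_gt0 e0 qp).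
  rewrite addr0 => /le_trans; apply.
  by rewrite -[X in _ + X]mulr1 -mulrDr divfK// gt_eqF.
move=> e0.
have [r r0 Hr] := absolutely_continuous_seq acf e0.
(* No derivative is assumed at [p] and [q], so both endpoints join the exceptional null set. *)
pose M := N `|` [set p] `|` [set q].
have mM : measurable M by do 2?apply: measurableU.
have M0 : lebesgue_measure M = 0%E.
  apply/negligibleP => //; do 2?apply: negligibleU.
  - by exists N; split => //; exact: subset_refl.
  - by exists [set p]; split => //; exact: lebesgue_measure_set1.
  - by exists [set q]; split => //; exact: lebesgue_measure_set1.
have [|U [oU MU Ur]] := @lebesgue_regularity_outer R M r mM _ r0.
  by apply: le_lt_trans (ltry 0); rewrite le_eqVlt; apply/orP; left; apply/eqP; exact: M0.
have mU := measurable_realfun.open_measurable oU.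
have Ulr : (lebesgue_measure U < r%:E)%E.
  rewrite (measureDI lebesgue_measure mU mM).
  rewrite [X in (_ + X)%E](_ : _ = 0%E); first by rewrite adde0.
  by rewrite setIidr.
(* [s] lists the pieces with exceptional tags. Charging their length to the measure of [U] within
   []u, v]] makes the claim additive under concatenation. *)
pose Q u v := exists s : seq (R * R),
  [/\ all (fun x => [&& u <= x.1, x.1 <= x.2 & x.2 <= v]) s,
      pairwise (fun x y => x.2 <= y.1) s,
      ((\sum_(x <- s) (x.2 - x.1))%:E <= lebesgue_measure (U `&` `]u, v]))%E &
      f v - f u <= e * (v - u) + \sum_(x <- s) `|f x.2 - f x.1|].
suff [s [sall spair slen sf]] : Q p q.
  apply: (le_trans sf); rewrite lerD2l; apply/ltW/Hr => //.
  rewrite -lte_fin; apply: le_lt_trans Ulr; apply: (le_trans slen).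
  by apply: measureIl => //; exact: measurable_itv.
apply: cousin => // [u v w pu uv vw wq [s [s1 s2 s3 s4]] [z [z1 z2 z3 z4]]|x xpq].
  exists (s ++ z); split.
  - rewrite all_cat; apply/andP; split.
      by apply: sub_all s1 => x /and3P[-> ->] /le_trans -> //; exact: ltW.
    by apply: sub_all z1 => x /and3P[vx -> ->]; rewrite (le_trans (ltW uv) vx).
  - rewrite pairwise_cat s2 z2 !andbT; apply/allrelP => x y xs yz.
    have /and3P[_ _ xv] := allP s1 _ xs; have /and3P[vy _ _] := allP z1 _ yz.
    exact: le_trans vy.
  - by rewrite big_cat/= EFinD -(@lebesgue_measure_splitI _ _ u v w oU) ?leeD// ltW.
  - rewrite big_cat/=; lra.
(* At an exceptional tag the gauge keeps the interval inside [U], and the interval itself is listed.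
   At any other tag the derivative bounds the increment up to [e], and the list is empty. *)
have [Mx|nMx] := pselect (M x).
  have [d /= d0 dU] : nbhs x U by apply: open_nbhs_nbhs; split => //; exact: MU.
  exists d => // u v [pu ux xv vq] uv xdu vxd; exists [:: (u, v)]; split => /=.
  - by rewrite !lexx ltW.
  - by [].
  - rewrite big_seq1/=.
    have -> : U `&` `]u, v] = `]u, v]%classic.
      apply/setIidPr => y /=; rewrite in_itv/= => /andP[uy yv].
      by apply: dU; rewrite /ball/= ltr_norml; lra.
    by rewrite lebesgue_measure_itv/= lte_fin uv.
  - rewrite big_seq1/=; apply: (le_trans (ler_norm _)).
    by rewrite lerDr mulr_ge0 ?subr_ge0 ?ltW.
have [df xdf df0] : exists2 df, is_derive x 1 f df & df <= 0.
  apply: contrapT => nd; apply: nMx.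
  have [->|xp] := eqVneq x p; first by left; right.
  have [->|xq] := eqVneq x q; first by right.
  by left; left; apply: subN => /=; apply/not_implyP; split => //; lra.
have [d d0 dx] := is_derive_approx xdf e0.
exists d => // u v [pu ux xv vq] uv xdu vxd; exists [::]; split => //=.
  by rewrite big_nil measure_ge0.
rewrite big_nil addr0.
have /ler_normlP[_ Hv] : `|f v - f x - df * (v - x)| <= e * `|v - x|.
  by apply: dx; rewrite ger0_norm ?subr_ge0// ltrBlDl.
have /ler_normlP[Hu _] : `|f u - f x - df * (u - x)| <= e * `|u - x|.
  by apply: dx; rewrite ler0_norm ?subr_le0// opprB ltrBlDr addrC -ltrBlDr.
rewrite ger0_norm ?subr_ge0// in Hv; rewrite ler0_norm ?subr_le0// in Hu.
have : df * (v - u) <= 0 by rewrite mulr_le0_ge0// subr_ge0 ltW.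
lra.
Qed.

Lemma absolutely_continuousD (R : realType) (p q : R) (f g : R -> R) :
  absolutely_continuous p q f -> absolutely_continuous p q g ->
  absolutely_continuous p q (fun t => f t + g t).
Proof.
move=> acf acg e e0; have e20 : 0 < e / 2 by rewrite divr_gt0.
have [r r0 Hr] := acf _ e20; have [r' r'0 Hr'] := acg _ e20.
exists (Num.min r r'); first by rewrite lt_min r0.
move=> n u v uv tuv; rewrite lt_min => /andP[/(Hr n u v uv tuv) sf /(Hr' n u v uv tuv) sg].
apply: (@le_lt_trans _ _ (\sum_i (`|f (v i) - f (u i)| + `|g (v i) - g (u i)|))).
  by apply: ler_sum => i _; rewrite opprD addrACA ler_normD.
by rewrite big_split/=; lra.
Qed.

Definition lipschitz_on (R : realType) (L p q : R) (f : R -> R) : Prop :=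
  forall s t, p <= s -> s <= t -> t <= q -> `|f t - f s| <= L * (t - s).

Lemma lipschitz_absolutely_continuous (R : realType) (L p q : R) (f : R -> R) :
  lipschitz_on L p q f -> absolutely_continuous p q f.
Proof.
move=> lf e e0; have L0 : 0 < `|L| + 1 by rewrite ltr_wpDl.
exists (e / (`|L| + 1)); first by rewrite divr_gt0.
move=> n u v uv _; rewrite ltr_pdivlMr// => suv.
apply: le_lt_trans suv; rewrite mulr_suml; apply: ler_sum => i _.
have [pu uvi vq] := uv i; apply: (le_trans (lf _ _ pu uvi vq)).
by rewrite mulrC ler_wpM2l ?subr_ge0//; have := ler_norm L; lra.
Qed.

Lemma lebesgue_aeS (R : realType) (P Q : R -> Prop) :
  (forall t, P t -> Q t) -> {ae (@lebesgue_measure R), forall t, P t} ->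
  {ae (@lebesgue_measure R), forall t, Q t}.
Proof. by move=> PQ; apply: negligibleS => t /= nQ /PQ. Qed.

(** Mean value inequality: subtracting [C t] reduces it to the nonincreasing case. *)
Lemma absolutely_continuous_le (R : realType) (p q C : R) (f : R -> R) :
  p <= q -> absolutely_continuous p q f ->
  {ae (@lebesgue_measure R), forall t, p < t < q ->
    exists2 df, is_derive t 1 f df & df <= C} ->
  f q - f p <= C * (q - p).
Proof.
move=> pq acf df.
have : f q + - C * q <= f p + - C * p.
  apply: (absolutely_continuous_nonincreasing (f := fun t => f t + - C * t)) => //.
    apply: absolutely_continuousD => //.
    apply: (@lipschitz_absolutely_continuous _ `|C|) => s t ps st tq.
    by rewrite -mulrBr normrM normrN (ger0_norm (x := t - s)) ?subr_ge0.
  apply: lebesgue_aeS df => t H /H [d dft dC]; exists (d + - C); last by rewrite subr_le0.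
  have -> : (fun t => f t + - C * t) = f + (- C) \*: id by [].
  by apply: is_derive_eq; rewrite -[_ *: _]/(_ * _) mulr1.
by rewrite mulrBr !mulNr; lra.
Qed.

Lemma absolutely_continuousN (R : realType) (p q : R) (f : R -> R) :
  absolutely_continuous p q f -> absolutely_continuous p q (fun t => - f t).
Proof.
move=> acf e e0; have [r r0 Hr] := acf e e0; exists r => // n u v uv tuv suv.
by under eq_bigr do rewrite -opprD normrN; exact: Hr.
Qed.

Lemma absolutely_continuous_ge (R : realType) (p q C : R) (f : R -> R) :
  p <= q -> absolutely_continuous p q f ->
  {ae (@lebesgue_measure R), forall t, p < t < q ->
    exists2 df, is_derive t 1 f df & C <= df} ->
  C * (q - p) <= f q - f p.
Proof.
move=> pq acf df; rewrite -lerN2 opprB.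
have := @absolutely_continuous_le _ p q (- C) (fun t => - f t) pq (absolutely_continuousN acf).
rewrite mulNr opprK addrC; apply; apply: lebesgue_aeS df => t H /H[d dft Cd].
by exists (- d); [exact: is_deriveN|rewrite lerN2].
Qed.

(** * Uniqueness inside a zone of smoothness *)

Lemma complexP (R : realType) (z w : R[i]) :
  complex.Re z = complex.Re w -> complex.Im z = complex.Im w -> z = w.
Proof. by case: z w => [? ?] [? ?] /= -> ->. Qed.

Lemma absolutely_continuous_continuous (R : realType) (f : R -> R) :
  (forall p q, absolutely_continuous p q f) -> continuous f.
Proof.
move=> acf t; apply/cvgrPdist_lt => e e0.
have [r r0 Hr] := absolutely_continuous_seq (acf (t - 1) (t + 1)) e0.
have one s s' : t - 1 <= s -> s <= s' -> s' <= t + 1 -> s' - s < r ->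
    `|f s' - f s| < e.
  move=> ts ss' s't sr; have := Hr [:: (s, s')]; rewrite /= !big_seq1/=; apply => //.
  by rewrite ts ss' s't.
near=> s.
have /ltr_normlP[st1 st2] : `|t - s| < r by near: s; exact: cvgr_dist_lt.
have /ltr_normlP[st3 st4] : `|t - s| < 1 by near: s; exact: cvgr_dist_lt.
have [st|/ltW ts] := leP s t; first by apply: one => //; lra.
by rewrite distrC; apply: one => //; lra.
Unshelve. all: by end_near. Qed.

Lemma continuous_segment_bounded (R : realType) (f : R -> R) (p q : R) :
  p <= q -> continuous f -> exists M, forall t, p <= t <= q -> `|f t| <= M.
Proof.
move=> pq cf.
have cn : {within `[p, q], continuous (fun t => `|f t|)}.
  apply: continuous_subspaceT => t; apply: continuous_comp; first exact: cf.
  exact: norm_continuous.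
have [c _ H] := EVT_max pq cn; exists `|f c| => t tpq.
by apply: H; rewrite in_itv.
Qed.

Lemma continuous_derive_lipschitz (R : realType) (f df : R -> R) (p q : R) :
  p <= q -> (forall t : R, is_derive t 1 f (df t)) -> continuous df ->
  exists L, lipschitz_on L p q f.
Proof.
move=> pq fdf cdf; have [M HM] := continuous_segment_bounded pq cdf.
exists M => s t ps st tq.
have cf : {within `[s, t], continuous f}.
  apply: continuous_subspaceT => x; apply: differentiable_continuous.
  by apply/derivable1_diffP; case: (fdf x).
have [c] := MVT_segment st (fun x _ => fdf x) cf.
rewrite in_itv/= => /andP[sc ct] ->; rewrite normrM (ger0_norm (x := t - s)) ?subr_ge0//.
by rewrite ler_wpM2r ?subr_ge0// HM//; lra.
Qed.

(** Phrased with coordinates and the taxicab distance, because absolute continuity and derivatives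
    of solutions are handled for real and imaginary parts separately. *)
Definition locally_lipschitz (R : realType) (X : R[i] -> R[i]) : Prop :=
  forall M : R, exists2 L : R, 0 <= L & forall z w : R[i],
    [/\ `|complex.Re z| <= M, `|complex.Im z| <= M,
        `|complex.Re w| <= M & `|complex.Im w| <= M] ->
    let n := `|complex.Re z - complex.Re w| + `|complex.Im z - complex.Im w| in
    `|complex.Re (X z) - complex.Re (X w)| <= L * n /\
    `|complex.Im (X z) - complex.Im (X w)| <= L * n.

Definition has_velocity (R : realType) (g : R -> R[i]) (t : R) (v : R[i]) : Prop :=
  is_derive t 1 (fun s => complex.Re (g s)) (complex.Re v) /\
  is_derive t 1 (fun s => complex.Im (g s)) (complex.Im v).

Lemma has_velocity_shift (R : realType) (g : R -> R[i]) (t c : R) (v : R[i]) :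
  has_velocity g (t + c) v -> has_velocity (fun s => g (s + c)) t v.
Proof.
move=> [gR gI].
have dshift : is_derive t 1 (shift c) (1 : R) by exact: is_derive_shift.
split.
  have := @is_derive1_comp _ (fun s => complex.Re (g s)) (shift c) t _ _ gR dshift.
  by rewrite mulr1.
have := @is_derive1_comp _ (fun s => complex.Im (g s)) (shift c) t _ _ gI dshift.
by rewrite mulr1.
Qed.

(** Global in time, which suffices here: spirals never stop, nor do central trajectories with
    positive real part of [1 / z ^ 2], which then avoids 0. *)
Definition trajectory (R : realType) (X : R[i] -> R[i]) (h : R -> R[i]) : Prop :=
  forall t : R, has_velocity h t (X (h t)).

Definition continuous_curve (R : realType) (h : R -> R[i]) : Prop :=
  continuous (fun t => complex.Re (h t)) /\ continuous (fun t => complex.Im (h t)).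

Lemma trajectory_continuous (R : realType) (X : R[i] -> R[i]) (h : R -> R[i]) :
  trajectory X h -> continuous_curve h.
Proof.
move=> Xh; split=> t; apply: differentiable_continuous; apply/derivable1_diffP.
  by case: (Xh t) => -[].
by case: (Xh t) => _ [].
Qed.

Lemma solution_continuous (R : realType) (F : R[i] -> set R[i]) (g : R -> R[i]) :
  filippov_solution F g -> continuous_curve g.
Proof. by move=> [? ? _]; split; exact: absolutely_continuous_continuous. Qed.

Lemma curve_near (R : realType) (h : R -> R[i]) (t e : R) :
  continuous_curve h -> 0 < e -> exists2 r, 0 < r & forall s, `|s - t| < r ->
    `|complex.Re (h s) - complex.Re (h t)| < e /\
    `|complex.Im (h s) - complex.Im (h t)| < e.
Proof.
move=> [cR cI] e0.
have /cvgrPdist_lt/(_ _ e0)[r1 /= r10 H1] := cR t.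
have /cvgrPdist_lt/(_ _ e0)[r2 /= r20 H2] := cI t.
exists (Num.min r1 r2); first by rewrite lt_min r10.
move=> s; rewrite lt_min => /andP[s1 s2]; split; rewrite distrC.
  by apply: H1; rewrite /ball/= distrC.
by apply: H2; rewrite /ball/= distrC.
Qed.

Lemma locally_lipschitz_continuous (R : realType) (X : R[i] -> R[i]) (h : R -> R[i]) :
  locally_lipschitz X -> continuous_curve h -> continuous_curve (fun t => X (h t)).
Proof.
move=> lX ch.
suff H t e : 0 < e -> exists2 r, 0 < r & forall s, `|s - t| < r ->
    `|complex.Re (X (h s)) - complex.Re (X (h t))| < e /\
    `|complex.Im (X (h s)) - complex.Im (X (h t))| < e.
  split=> t; apply/cvgrPdist_lt => e /(H t)[r r0 Hr]; exists r => // s /=;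
  by rewrite distrC => /Hr[]; rewrite ![`|_ - _ (X (h s))|]distrC.
move=> e0.
pose M := `|complex.Re (h t)| + `|complex.Im (h t)| + 1.
have [L L0 HL] := lX M.
have L10 : 0 < 2 * L + 1 by lra.
have d0 : 0 < Num.min 1 (e / (2 * L + 1)) by rewrite lt_min ltr01 divr_gt0.
have [r r0 Hr] := curve_near t ch d0; exists r => // s /Hr.
rewrite !lt_min !ltr_pdivlMr// => -[/andP[R1 R2] /andP[I1 I2]].
have box : [/\ `|complex.Re (h s)| <= M, `|complex.Im (h s)| <= M,
    `|complex.Re (h t)| <= M & `|complex.Im (h t)| <= M].
  have := ler_normD (complex.Re (h s) - complex.Re (h t)) (complex.Re (h t)).
  have := ler_normD (complex.Im (h s) - complex.Im (h t)) (complex.Im (h t)).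
  have := normr_ge0 (complex.Re (h t)); have := normr_ge0 (complex.Im (h t)).
  by rewrite !subrK /M => *; split; lra.
have [HR HI] := HL _ _ box.
move: HR HI; set nR := `|complex.Re (h s) - _|; set nI := `|complex.Im (h s) - _|.
have : 0 <= nR := normr_ge0 _. have : 0 <= nI := normr_ge0 _.
rewrite -/nR -/nI in R2 I2.
move=> *; split; nra.
Qed.

Lemma trajectory_lipschitz (R : realType) (X : R[i] -> R[i]) (h : R -> R[i]) (p q : R) :
  p <= q -> locally_lipschitz X -> trajectory X h ->
  exists L, lipschitz_on L p q (fun t => complex.Re (h t)) /\
            lipschitz_on L p q (fun t => complex.Im (h t)).
Proof.
move=> pq lX Xh.
have [cR cI] := locally_lipschitz_continuous lX (trajectory_continuous Xh).
have [L1 H1] := continuous_derive_lipschitz pq (fun t => (Xh t).1) cR.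
have [L2 H2] := continuous_derive_lipschitz pq (fun t => (Xh t).2) cI.
exists (Num.max L1 L2); split=> s t ps st tq.
  by apply: (le_trans (H1 s t ps st tq)); rewrite ler_wpM2r ?subr_ge0// le_max lexx.
by apply: (le_trans (H2 s t ps st tq)); rewrite ler_wpM2r ?subr_ge0// le_max lexx orbT.
Qed.

Lemma trajectory_shift (R : realType) (X : R[i] -> R[i]) (h : R -> R[i]) (c : R) :
  trajectory X h -> trajectory X (fun t => h (t + c)).
Proof. by move=> Xh t; exact: has_velocity_shift (Xh (t + c)). Qed.

Lemma absolutely_continuous_norm_le (R : realType) (p q C : R) (f : R -> R) :
  p <= q -> absolutely_continuous p q f ->
  {ae (@lebesgue_measure R), forall t, p < t < q ->
    exists2 df, is_derive t 1 f df & `|df| <= C} ->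
  `|f q - f p| <= C * (q - p).
Proof.
move=> pq acf df; rewrite ler_norml -mulNr; apply/andP; split.
  apply: absolutely_continuous_ge => //; apply: lebesgue_aeS df => t H /H[d dt].
  by rewrite ler_norml => /andP[? _]; exists d.
apply: absolutely_continuous_le => //; apply: lebesgue_aeS df => t H /H[d dt].
by rewrite ler_norml => /andP[_ ?]; exists d.
Qed.

Lemma absolutely_continuousB (R : realType) (p q : R) (f g : R -> R) :
  absolutely_continuous p q f -> absolutely_continuous p q g ->
  absolutely_continuous p q (fun t => f t - g t).
Proof.
by move=> acf /absolutely_continuousN acg; exact: absolutely_continuousD.
Qed.

Lemma continuous_dist (R : realType) (f g : R -> R) :
  continuous f -> continuous g -> continuous (fun t => `|f t - g t|).
Proof.
move=> cf cg t.
apply: (@continuous_comp _ _ _ (fun t => f t - g t) (fun x => `|x|)); last first.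
  exact: norm_continuous.
by apply: continuousB; [exact: cf|exact: cg].
Qed.

Definition ae_trajectory (R : realType) (X : R[i] -> R[i]) (p q : R)
    (g : R -> R[i]) : Prop :=
  {ae (@lebesgue_measure R), forall t : R, p < t < q ->
    has_velocity g t (X (g t))}.

(** In place of Gronwall, the distance [n] of the two curves is maximised on a short interval, at
    [c]. The mean value inequality gives [n c <= 2 L (c - t0) n c] with a factor at most 1/2, so [n]
    vanishes. *)
Lemma local_uniqueness (R : realType) (X : R[i] -> R[i]) (g h : R -> R[i])
    (t0 r : R) :
  locally_lipschitz X ->
  (forall p q, absolutely_continuous p q (fun t => complex.Re (g t))) ->
  (forall p q, absolutely_continuous p q (fun t => complex.Im (g t))) ->
  trajectory X h -> g t0 = h t0 -> 0 < r -> ae_trajectory X t0 (t0 + r) g ->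
  exists2 d, 0 < d & forall t, t0 <= t <= t0 + d -> g t = h t.
Proof.
move=> lX acR acI Xh gh0 r0 Xg.
have cg : continuous_curve g by split; exact: absolutely_continuous_continuous.
have ch := trajectory_continuous Xh.
pose M := `|complex.Re (h t0)| + `|complex.Im (h t0)| + 1.
have [L L0 HL] := lX M.
have [r1 r10 Hr1] := curve_near t0 cg ltr01.
have [r2 r20 Hr2] := curve_near t0 ch ltr01.
have bound k : `|complex.Re k - complex.Re (h t0)| < 1 /\
    `|complex.Im k - complex.Im (h t0)| < 1 ->
    `|complex.Re k| <= M /\ `|complex.Im k| <= M.
  rewrite /M; move: (complex.Re k) (complex.Im k) (complex.Re (h t0)) (complex.Im (h t0)).
  clear=> x y x0 y0 [xx yy].
  have := ler_normD (x - x0) x0; have := ler_normD (y - y0) y0.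
  by rewrite !subrK; have := normr_ge0 x0; have := normr_ge0 y0 => *; split; lra.
have L4 : 0 < 4 * L + 4 by lra.
(* [(4 * L + 4)^-1] makes [2 L d] at most 1/2 and stays meaningful for [L = 0]; [r1 / 2] and
   [r2 / 2] keep both curves in the box where [L] is valid. *)
pose d := Num.min (Num.min (r / 2) (4 * L + 4)^-1) (Num.min (r1 / 2) (r2 / 2)).
have d0 : 0 < d by rewrite !lt_min invr_gt0 L4 !divr_gt0.
have [dr dL dr1 dr2] : [/\ d <= r / 2, d <= (4 * L + 4)^-1, d <= r1 / 2 & d <= r2 / 2].
  by split; rewrite !ge_min lexx ?orbT.
exists d => // t ttd.
pose n t := `|complex.Re (g t) - complex.Re (h t)| +
            `|complex.Im (g t) - complex.Im (h t)|.
have cn : {within `[t0, t0 + d], continuous n}.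
  apply: continuous_subspaceT => s.
  apply: (@continuousD _ _ _ (fun t => `|complex.Re (g t) - complex.Re (h t)|)
    (fun t => `|complex.Im (g t) - complex.Im (h t)|)).
    by apply: continuous_dist; [exact: cg.1|exact: ch.1].
  by apply: continuous_dist; [exact: cg.2|exact: ch.2].
have t0d : t0 <= t0 + d by rewrite lerDl ltW.
have [c] := EVT_max t0d cn; rewrite in_itv/= => /andP[t0c ctd] nmax.
have near_t0 s : t0 < s < c -> `|s - t0| < r1 /\ `|s - t0| < r2 /\ s < t0 + r.
  move=> /andP[ts sc]; rewrite ger0_norm ?subr_ge0 ?ltW//.
  have sd : s - t0 < d by rewrite ltrBlDl (lt_le_trans sc).
  by clear -sd dr dr1 dr2 r0 r10 r20; lra.
have drift s : t0 < s < c ->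
    `|complex.Re (X (g s)) - complex.Re (X (h s))| <= L * n c /\
    `|complex.Im (X (g s)) - complex.Im (X (h s))| <= L * n c.
  move=> tsc; have [s1 [s2 _]] := near_t0 s tsc.
  have := Hr1 s s1; rewrite gh0 => /bound[Rg Ig].
  have /bound[Rh Ih] := Hr2 s s2.
  have [HR HI] := HL (g s) (h s) (And4 Rg Ig Rh Ih).
  have ns : n s <= n c.
    apply: nmax; rewrite in_itv/=; case/andP: tsc => ts sc.
    by rewrite (ltW ts) (le_trans (ltW sc)).
  by split; [apply: (le_trans HR)|apply: (le_trans HI)]; rewrite ler_wpM2l.
have [LR [lhR lhI]] := trajectory_lipschitz t0c lX Xh.
have nR : `|(complex.Re (g c) - complex.Re (h c)) -
    (complex.Re (g t0) - complex.Re (h t0))| <= L * n c * (c - t0).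
  apply: (absolutely_continuous_norm_le (f := fun t => complex.Re (g t) - complex.Re (h t))) => //.
    by apply: absolutely_continuousB => //; exact: lipschitz_absolutely_continuous lhR.
  apply: lebesgue_aeS Xg => s H tsc; have [_ [_ sr]] := near_t0 s tsc.
  have [|gR _] := H; first by case/andP: tsc => ->.
  exists (complex.Re (X (g s)) - complex.Re (X (h s))); last by case: (drift s tsc).
  by have [hR _] := Xh s; exact: is_deriveB.
have nI : `|(complex.Im (g c) - complex.Im (h c)) -
    (complex.Im (g t0) - complex.Im (h t0))| <= L * n c * (c - t0).
  apply: (absolutely_continuous_norm_le (f := fun t => complex.Im (g t) - complex.Im (h t))) => //.
    by apply: absolutely_continuousB => //; exact: lipschitz_absolutely_continuous lhI.
  apply: lebesgue_aeS Xg => s H tsc; have [_ [_ sr]] := near_t0 s tsc.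
  have [|_ gI] := H; first by case/andP: tsc => ->.
  exists (complex.Im (X (g s)) - complex.Im (X (h s))); last by case: (drift s tsc).
  by have [_ hI] := Xh s; exact: is_deriveB.
rewrite gh0 !subrr !subr0 in nR nI.
have nc0 : n c <= 0.
  have n0 : 0 <= n c by rewrite addr_ge0.
  have ct : c - t0 <= (4 * L + 4)^-1 by rewrite lerBlDl (le_trans ctd)// lerD2l.
  have : n c <= 2 * (L * n c * (c - t0)) by rewrite [leLHS]/n; lra.
  have Ln : L * n c * (c - t0) <= L * n c * (4 * L + 4)^-1.
    by rewrite ler_wpM2l// mulr_ge0.
  have L14 : L * (4 * L + 4)^-1 <= 4^-1.
    by rewrite ler_pdivrMr//; clear; lra.
  have : L * n c * (4 * L + 4)^-1 <= n c * 4^-1.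
    by rewrite mulrAC mulrC ler_wpM2l.
  by clear -Ln n0; lra.
have : n t <= 0 by apply: le_trans nc0; exact: nmax.
have := normr_ge0 (complex.Re (g t) - complex.Re (h t)).
have := normr_ge0 (complex.Im (g t) - complex.Im (h t)).
rewrite /n => nI0 nR0 nt.
have /eqP : `|complex.Re (g t) - complex.Re (h t)| = 0 by clear -nI0 nR0 nt; lra.
have /eqP : `|complex.Im (g t) - complex.Im (h t)| = 0 by clear -nI0 nR0 nt; lra.
by rewrite !normr_eq0 !subr_eq0 => /eqP ? /eqP ?; exact: complexP.
Qed.

(** Real induction along [h]: agreement passes to limits by continuity, and [local_uniqueness]
    prolongs it while the solution stays in the open zone [J]. Only the start is delicate, as [h 0]
    may lie on a discontinuity line; this is the purpose of the last hypothesis. *)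
Lemma solution_follows (R : realType) (F : R[i] -> set R[i]) (X : R[i] -> R[i])
    (J : set R) (g h : R -> R[i]) (tau T : R) :
  filippov_solution F g -> locally_lipschitz X -> open J ->
  (forall z, J (complex.Im z) -> F z = [set X z]) ->
  trajectory X h -> g tau = h 0 ->
  (forall t, 0 < t < T -> J (complex.Im (h t))) ->
  (exists2 r, 0 < r & forall t, tau < t < tau + r -> J (complex.Im (g t))) ->
  forall t, 0 <= t <= T -> g (tau + t) = h t.
Proof.
move=> solg lX oJ FX Xh g0 hJ [r r0 gJ].
have [acR acI aeg] := solg; have cg := solution_continuous solg.
have ch := trajectory_continuous Xh.
have Xh' := trajectory_shift (- tau) Xh.
have ch' := trajectory_continuous Xh'.
apply: real_induction => [|t /andP[t0 tT] IH|t /andP[t0 tT] IH].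
- by rewrite addr0.
- have lim_eq (f k : R -> R) : continuous f -> continuous k ->
      (forall s, 0 <= s < t -> f (tau + s) = k (tau + s)) -> f (tau + t) = k (tau + t).
    move=> cf ck fk; apply/eqP; rewrite -subr_eq0 -normr_eq0 eq_le normr_ge0 andbT.
    rewrite leNgt; apply/negP => d0.
    have /cvgrPdist_lt/(_ _ d0)[d /= dd0 Hd] := continuous_dist cf ck (x := tau + t).
    pose s := Num.max 0 (t - d / 2).
    have st : 0 <= s < t by rewrite le_max lexx/= gt_max t0; lra.
    have sd : `|tau + t - (tau + s)| < d.
      have [s0 ts] : s < t /\ t - d / 2 <= s by rewrite le_max lexx orbT; case/andP: st.
      rewrite opprD addrACA subrr add0r ger0_norm; last by rewrite subr_ge0 ltW.
      by clear -ts dd0; lra.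
    by have := Hd _ sd; rewrite /= (fk s st) subrr normr0 subr0 normr_id ltxx.
  have h'E s : h s = h (tau + s - tau) by rewrite addrAC subrr add0r.
  rewrite [RHS]h'E; apply: complexP.
    apply: (lim_eq (fun s => complex.Re (g s)) (fun s => complex.Re (h (s - tau))) cg.1 ch'.1).
    by move=> s st; rewrite -h'E IH.
  apply: (lim_eq (fun s => complex.Im (g s)) (fun s => complex.Im (h (s - tau))) cg.2 ch'.2).
  by move=> s st; rewrite -h'E IH.
- have gt : g (tau + t) = h t by apply: IH; rewrite t0 lexx.
  have [r' r'0 gJ'] : exists2 r', 0 < r' &
      forall s, tau + t < s < tau + t + r' -> J (complex.Im (g s)).
    (* At [t = 0] the window is the assumed immediate entry into [J]; afterwards it comes from the
       openness of [J] around the height of [h t]. *)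
    move: t0; rewrite le_eqVlt => /predU1P[<-|t0]; first by exists r; rewrite ?addr0.
    have : nbhs (complex.Im (g (tau + t))) J.
      by apply: open_nbhs_nbhs; split; rewrite // gt; apply: hJ; rewrite t0.
    move=> /(cg.2 (tau + t))[d /= d0 Hd]; exists d => // s /andP[ts std].
    apply: Hd; rewrite /ball/= distrC ger0_norm ?subr_ge0 ?ltW// ltrBlDl//.
  have [||d d0 Hd] := @local_uniqueness _ X g (fun s => h (s - tau)) (tau + t) r'
      lX acR acI Xh' _ r'0.
  + by rewrite addrAC subrr add0r.
  + apply: lebesgue_aeS aeg => s [v Fv [dR dI]] /gJ'/FX FE.
    by move: Fv; rewrite FE/= => <-.
  + exists (t + d); first by rewrite ltrDl.
    move=> s /andP[ts sd] _; rewrite Hd; first by rewrite addrAC subrr add0r.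
    by rewrite lerD2l -addrA lerD2l sd ltW.
Qed.

(** * Arcs forced by their initial point *)

(** Lipschitz coordinates and a finite list of exceptional times survive concatenation and, up to
    countably many times, periodic extension; they imply absolute continuity and the inclusion
    almost everywhere. *)
Definition arc (R : realType) (F : R[i] -> set R[i]) (T : R) (h : R -> R[i]) : Prop :=
  (exists2 L : R, 0 <= L & lipschitz_on L 0 T (fun t => complex.Re (h t)) /\
                           lipschitz_on L 0 T (fun t => complex.Im (h t))) /\
  exists E : seq R, forall t, 0 < t < T -> t \notin E ->
    exists2 v, F (h t) v & has_velocity h t v.

(** Existence and forward uniqueness are kept together: the curve builds the cycle, and the last
    clause constrains competing orbits. [Q] records the region travelled. *)
Definition forced_arc (R : realType) (F : R[i] -> set R[i]) (Q : R[i] -> Prop)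
    (p q : R[i]) (T : R) : Prop :=
  0 < T /\ exists h : R -> R[i], [/\ h 0 = p, h T = q, arc F T h,
    forall t, 0 <= t <= T -> Q (h t) &
    forall g tau, filippov_solution F g -> g tau = p ->
      forall t, 0 <= t <= T -> g (tau + t) = h t].

Lemma has_velocity_near (R : realType) (g h : R -> R[i]) (t : R) (v : R[i]) :
  (\forall s \near t, g s = h s) -> has_velocity g t v -> has_velocity h t v.
Proof.
move=> gh [gR gI]; split.
  by apply: near_eq_is_derive gR; apply: filterS gh => s ->.
by apply: near_eq_is_derive gI; apply: filterS gh => s ->.
Qed.

Lemma has_velocity_opp (R : realType) (g : R -> R[i]) (t : R) (v : R[i]) :
  has_velocity g t v -> has_velocity (fun s => - g s) t (- v).
Proof.
move=> [gR gI]; split.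
  have -> : complex.Re (- v) = - complex.Re v by case: v {gR gI}.
  have -> : (fun s => complex.Re (- g s)) = (fun s => - complex.Re (g s)).
    by apply/funext => s; case: (g s).
  exact: is_deriveN.
have -> : complex.Im (- v) = - complex.Im v by case: v {gR gI}.
have -> : (fun s => complex.Im (- g s)) = (fun s => - complex.Im (g s)).
  by apply/funext => s; case: (g s).
exact: is_deriveN.
Qed.

Lemma lipschitz_on_split (R : realType) (L p m q : R) (f : R -> R) :
  lipschitz_on L p m f -> lipschitz_on L m q f -> lipschitz_on L p q f.
Proof.
move=> l1 l2 s t ps st tq.
have [tm|mt] := leP t m; first exact: l1.
have [ms|sm] := leP m s; first exact: l2.
rewrite -(subrK (f m) (f t)) -addrA (le_trans (ler_normD _ _))//.
have := l1 s m ps (ltW sm) (lexx _); have := l2 m t (lexx _) (ltW mt) tq.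
by clear; lra.
Qed.

Lemma lipschitz_onW (R : realType) (L L' p q : R) (f : R -> R) :
  L <= L' -> lipschitz_on L p q f -> lipschitz_on L' p q f.
Proof.
move=> LL' lf s t ps st tq; apply: (le_trans (lf s t ps st tq)).
by rewrite ler_wpM2r ?subr_ge0.
Qed.

Lemma eq_lipschitz_on (R : realType) (L p q : R) (f g : R -> R) :
  (forall t, p <= t <= q -> f t = g t) -> lipschitz_on L p q f ->
  lipschitz_on L p q g.
Proof.
move=> fg lf s t ps st tq; rewrite -!fg; first exact: lf.
  by rewrite ps (le_trans st).
by rewrite tq (le_trans ps).
Qed.

Lemma lipschitz_on_shift (R : realType) (L p q c : R) (f : R -> R) :
  lipschitz_on L p q f ->
  lipschitz_on L (p - c) (q - c) (fun t => f (t + c)).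
Proof.
move=> lf s t ps st tq.
have -> : t - s = (t + c) - (s + c) by clear; lra.
by apply: lf; clear -ps st tq; lra.
Qed.

(** Any solution through [p] is at [q] after time [T], so the second uniqueness clause takes over
    where the first stops. *)
Lemma forced_arc_trans (R : realType) (F : R[i] -> set R[i]) (Q : R[i] -> Prop)
    (p q r : R[i]) (T U : R) :
  forced_arc F Q p q T -> forced_arc F Q q r U -> forced_arc F Q p r (T + U).
Proof.
move=> [T0 [h [h0 hT [[L L0 [hR hI]] [E hE]] hQ hu]]].
move=> [U0 [k [k0 kU [[M M0 [kR kI]] [D kD]] kQ ku]]].
split; first exact: addr_gt0.
pose w t := if t < T then h t else k (t + - T).
have wh t : t <= T -> w t = h t.
  by rewrite /w le_eqVlt => /predU1P[->|->//]; rewrite ltxx subrr k0 hT.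
have wk t : T <= t -> w t = k (t + - T) by rewrite /w ltNge => ->.
have LM : L <= Num.max L M by rewrite le_max lexx.
have ML : M <= Num.max L M by rewrite le_max lexx orbT.
have wl (f : R[i] -> R) : lipschitz_on L 0 T (fun t => f (h t)) ->
    lipschitz_on M 0 U (fun t => f (k t)) ->
    lipschitz_on (Num.max L M) 0 (T + U) (fun t => f (w t)).
  move=> lh lk; apply: (@lipschitz_on_split _ _ _ T).
    by apply: eq_lipschitz_on (lipschitz_onW LM lh) => t /andP[_ /wh ->].
  have := lipschitz_on_shift (c := - T) (lipschitz_onW ML lk).
  rewrite !opprK add0r (addrC U).
  by apply: eq_lipschitz_on => t /andP[/wk ->].
exists w; split.
- by rewrite wh// ltW.
- by rewrite wk ?lerDl ?ltW// addrAC subrr add0r.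
- split; first by exists (Num.max L M); [exact: le_trans LM|split; exact: wl].
  (* The junction time [T] becomes exceptional, since the velocity may jump there. *)
  exists (E ++ T :: [seq x + T | x <- D]) => t /andP[t0 tTU].
  rewrite mem_cat inE !negb_or => /and3P[tE tT tD].
  have [tlT|Tlt|tT'] := ltgtP t T; last by rewrite tT' eqxx in tT.
    have [v Fv hv] := hE t (ltac:(by rewrite t0)) tE; exists v; first by rewrite wh// ltW.
    apply: has_velocity_near hv; near=> s; rewrite wh// ltW//.
    by near: s; exact: lt_nbhsl.
  have [|| v Fv kv] := kD (t + - T).
  + by rewrite subr_gt0 Tlt ltrBlDl.
  + by apply: contra tD => tD; apply/mapP; exists (t + - T); rewrite ?subrK.
  exists v; first by rewrite wk// ltW.
  apply: has_velocity_near (has_velocity_shift kv); near=> s; rewrite wk// ltW//.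
  by near: s; exact: lt_nbhsr.
- move=> t /andP[t0 tTU]; have [tT|Tt] := leP t T.
    by rewrite wh//; apply: hQ; rewrite t0.
  by rewrite wk ?ltW//; apply: kQ; rewrite subr_ge0 ltW//= lerBlDl.
- move=> g tau sg gtau t /andP[t0 tTU].
  have [tT|Tt] := leP t T; first by rewrite wh//; apply: hu; rewrite ?t0.
  rewrite wk ?ltW//.
  have -> : tau + t = tau + T + (t + - T) by clear; lra.
  apply: ku => //; last by rewrite subr_ge0 ltW//= lerBlDl.
  by rewrite -hT; apply: hu; rewrite // ltW//=.
Unshelve. all: by end_near. Qed.

Lemma filippov_solution_opp (R : realType) (F G : R[i] -> set R[i]) (g : R -> R[i]) :
  (forall z v, F z v -> G (- z) (- v)) -> filippov_solution F g ->
  filippov_solution G (fun t => - g t).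
Proof.
move=> FG [acR acI aeg].
have ReN : (fun t => complex.Re (- g t)) = (fun t => - complex.Re (g t)).
  by apply/funext => t; case: (g t).
have ImN : (fun t => complex.Im (- g t)) = (fun t => - complex.Im (g t)).
  by apply/funext => t; case: (g t).
split.
- by move=> p q; rewrite ReN; exact: absolutely_continuousN.
- by move=> p q; rewrite ImN; exact: absolutely_continuousN.
- apply: lebesgue_aeS aeg => t [v Fv gv]; exists (- v); first exact: FG.
  exact: (has_velocity_opp gv).
Qed.

(** The first inclusion transports the curve; the second serves uniqueness, where a solution for [G]
    is reflected back to one for [F]. *)
Lemma forced_arc_opp (R : realType) (F G : R[i] -> set R[i]) (P Q : R[i] -> Prop)
    (p q : R[i]) (T : R) :
  (forall z v, F z v -> G (- z) (- v)) -> (forall z v, G z v -> F (- z) (- v)) ->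
  (forall z, P z -> Q (- z)) ->
  forced_arc F P p q T -> forced_arc G Q (- p) (- q) T.
Proof.
move=> FG GF PQ [T0 [h [h0 hT [[L L0 [hR hI]] [E hE]] hP hu]]]; split => //.
exists (fun t => - h t); split; rewrite ?h0 ?hT//.
- split.
    exists L => //; split=> s t ps st tq.
      have -> : complex.Re (- h t) - complex.Re (- h s) =
          - (complex.Re (h t) - complex.Re (h s)).
        by case: (h t) (h s) => [? ?] [? ?] /=; rewrite opprB opprK addrC.
      by rewrite normrN; exact: hR.
    have -> : complex.Im (- h t) - complex.Im (- h s) =
        - (complex.Im (h t) - complex.Im (h s)).
      by case: (h t) (h s) => [? ?] [? ?] /=; rewrite opprB opprK addrC.
    by rewrite normrN; exact: hI.
  exists E => t tT /hE[//|v Fv hv]; exists (- v); first exact: FG.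
  exact: has_velocity_opp.
- by move=> t /hP/PQ.
- move=> g tau sg gtau t tT.
  have := hu _ tau (filippov_solution_opp GF sg); rewrite gtau opprK.
  by move=> /(_ erefl t tT) <-; rewrite opprK.
Qed.

Lemma forced_arcW (R : realType) (F : R[i] -> set R[i]) (P Q : R[i] -> Prop)
    (p q : R[i]) (T : R) :
  (forall z, P z -> Q z) -> forced_arc F P p q T -> forced_arc F Q p q T.
Proof.
move=> PQ [T0 [h [h0 hT arch hP hu]]]; split=> //; exists h; split=> //.
by move=> t /hP/PQ.
Qed.

(** * Periodic extension of closed arcs *)

Definition periodize (R : realType) (V : Type) (T : R) (h : R -> V) (t : R) : V :=
  h (t - (Num.floor (t / T))%:~R * T).

Lemma floor_mul_itv (R : realType) (T t : R) : 0 < T ->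
  (Num.floor (t / T))%:~R * T <= t < (Num.floor (t / T) + 1)%:~R * T.
Proof.
by move=> T0; rewrite -ler_pdivlMr// -ltr_pdivrMr// floor_itv.
Qed.

(** The window is closed on both sides: at its right end the floor has already jumped, and
    [h 0 = h T] reconciles the two values. *)
Lemma periodizeE (R : realType) (V : Type) (T : R) (h : R -> V) (k : int) (t : R) :
  0 < T -> h 0 = h T -> k%:~R * T <= t <= (k + 1)%:~R * T ->
  periodize T h t = h (t - k%:~R * T).
Proof.
move=> T0 h0T /andP[kt]; rewrite /periodize le_eqVlt => /predU1P[->|tk].
  rewrite mulfK ?gt_eqF// intrKfloor subrr h0T; congr h.
  by rewrite rmorphD/= mulrDl mul1r addrAC subrr add0r.
suff -> : Num.floor (t / T) = k by [].
by apply: floor_def; rewrite ler_pdivlMr// ltr_pdivrMr// kt.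
Qed.

Lemma periodize_periodic (R : realType) (V : Type) (T : R) (h : R -> V) (t : R) :
  0 < T -> h 0 = h T -> periodize T h (t + T) = periodize T h t.
Proof.
move=> T0 h0T; have /andP[kt tk] := floor_mul_itv t T0.
rewrite (@periodizeE _ _ _ _ (Num.floor (t / T)) t)// ?kt ?ltW//.
rewrite (@periodizeE _ _ _ _ (Num.floor (t / T) + 1) (t + T))//.
  by congr h; rewrite rmorphD/= mulrDl mul1r; clear; lra.
by move: kt tk; rewrite !rmorphD/= !mulrDl !mul1r; clear; lra.
Qed.

Lemma periodize_lipschitz (R : realType) (T L p q : R) (f : R -> R) :
  0 < T -> 0 <= L -> f 0 = f T -> lipschitz_on L 0 T f ->
  lipschitz_on L p q (periodize T f).
Proof.
move=> T0 L0 f0T lf s t _ st _; have /andP[ks sk] := floor_mul_itv s T0.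
have /andP[kt tk] := floor_mul_itv t T0.
set j := Num.floor (s / T) in ks sk; set k := Num.floor (t / T) in kt tk.
have jk : j <= k by apply: le_floor; rewrite ler_pM2r ?invr_gt0.
have sE : periodize T f s = f (s - j%:~R * T) by apply: periodizeE; rewrite ?ks ?ltW.
have tE : periodize T f t = f (t - k%:~R * T) by apply: periodizeE; rewrite ?kt ?ltW.
rewrite sE tE; move: sk tk; rewrite !rmorphD/= !mulrDl !mul1r => sk tk.
have [kj|kj] := eqVneq k j.
  rewrite kj in kt tk *.
  have -> : t - s = t - j%:~R * T - (s - j%:~R * T) by clear; lra.
  by apply: lf; move: ks st tk; clear; lra.
have jk1 : (j%:~R + 1) * T <= k%:~R * T.
  rewrite ler_pM2r// -[1]/(1%:~R) -rmorphD/= ler_int.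
  by rewrite lezD1 lt_neqAle eq_sym kj.
rewrite mulrDl mul1r in jk1.
(* Times in different periods are compared through the common value [f 0 = f T]: the rest of the
   first period and the beginning of the last are together no longer than [t - s]. *)
have -> : f (t - k%:~R * T) - f (s - j%:~R * T) =
    (f (t - k%:~R * T) - f 0) + (f T - f (s - j%:~R * T)).
  by rewrite f0T; clear; lra.
apply: (le_trans (ler_normD _ _)).
have ht : `|f (t - k%:~R * T) - f 0| <= L * (t - k%:~R * T - 0).
  by apply: lf => //; move: kt tk; clear; lra.
have hs : `|f T - f (s - j%:~R * T)| <= L * (T - (s - j%:~R * T)).
  by apply: lf => //; move: ks sk; clear; lra.
apply: (le_trans (lerD ht hs)); rewrite -mulrDr ler_wpM2l//.
by move: jk1; clear; lra.
Qed.

Lemma forced_arc_periodic (R : realType) (F : R[i] -> set R[i]) (Q : R[i] -> Prop)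
    (p : R[i]) (T : R) :
  forced_arc F Q p p T ->
  exists g : R -> R[i], [/\ filippov_solution F g, forall t, g (t + T) = g t,
    g 0 = p & forall t, Q (g t)].
Proof.
move=> [T0 [h [h0 hT [[L L0 [hR hI]] [E hE]] hQ _]]].
have h0T : h 0 = h T by rewrite h0 hT.
exists (periodize T h); split; last 3 first.
- by move=> t; exact: periodize_periodic.
- by rewrite (@periodizeE _ _ _ _ 0)// ?mul0r ?subrr// lexx add0r mul1r ltW.
- move=> t; apply: hQ; have /andP[kt tk] := floor_mul_itv t T0.
  by move: kt tk; rewrite rmorphD/= mulrDl mul1r; clear; lra.
split.
- move=> p' q'.
  apply: (@lipschitz_absolutely_continuous _ L).
  by apply: (@periodize_lipschitz _ T L _ _ (fun t => complex.Re (h t))) => //; rewrite h0T.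
- move=> p' q'.
  apply: (@lipschitz_absolutely_continuous _ L).
  by apply: (@periodize_lipschitz _ T L _ _ (fun t => complex.Im (h t))) => //; rewrite h0T.
(* All translates of the exceptional times and of the junction time 0 by multiples of [T]: a
   countable set, hence null. *)
pose N := \bigcup_(k in [set: int]) [set` [seq x + k%:~R * T | x <- 0 :: E]].
have cN : countable N.
  by apply: bigcup_countable => // k _; exact/finite_set_countable/finite_seq.
exists N; split.
- by apply: countable_measurable => // t; exact: measurable_set1.
- exact: countable_lebesgue_measure0.
move=> t /= nsol; apply: contrapT => nN; apply: nsol.
have /andP[kt tk] := floor_mul_itv t T0; set k := Num.floor (t / T) in kt tk.
pose u := t - k%:~R * T.
have uN : u \notin 0 :: E.
  apply/negP => uE; apply: nN; exists k => //; apply/mapP; exists u => //.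
  by rewrite subrK.
move: uN; rewrite inE negb_or => /andP[u0 uE].
have u_gt0 : 0 < u by rewrite lt_neqAle eq_sym u0 subr_ge0.
have uT : u < T by move: tk; rewrite rmorphD/= mulrDl mul1r /u; clear; lra.
have [|v Fv hv] := hE u _ uE; first by rewrite u_gt0.
exists v; first by rewrite (@periodizeE _ _ _ _ k)// kt ltW.
apply: has_velocity_near (has_velocity_shift hv); near=> s.
rewrite (@periodizeE _ _ _ _ k)//; apply/andP; split; apply: ltW; near: s.
  by apply: lt_nbhsr; rewrite -subr_gt0.
exact: lt_nbhsl.
Unshelve. all: by end_near. Qed.

Lemma periodic_add_mul (R : realType) (V : Type) (g : R -> V) (T t : R) (n : nat) :
  (forall t, g (t + T) = g t) -> g (t + n%:R * T) = g t.
Proof.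
move=> gT; elim: n => [|n IH]; first by rewrite mul0r addr0.
by rewrite -natr1 mulrDl mul1r addrA gT.
Qed.

(** Forced arcs control only the future of a point; by periodicity the forward half of an orbit is
    already all of it. *)
Lemma periodic_range (R : realType) (V : Type) (g : R -> V) (T tau : R) :
  0 < T -> (forall t, g (t + T) = g t) ->
  range g = [set g (tau + t) | t in [set t | 0 <= t]].
Proof.
move=> T0 gT; apply/seteqP; split=> [_ [s _ <-]|_ [t _ <-]]; last by exists (tau + t).
pose n := (Num.trunc (`|tau - s| / T)).+1.
have nT : tau - s <= n%:R * T.
  apply: (le_trans (ler_norm _)); rewrite -ler_pdivrMr//.
  by apply/ltW/truncnS_gt.
exists (s + n%:R * T - tau) => /=; first by move: nT; clear; lra.
by rewrite addrC subrK periodic_add_mul.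
Qed.

(** The arc closes up at [p], so both solutions are back at [p] after each time [T] and repeat the
    same arc; the periods [T1] and [T2] then recover the whole orbits from their forward halves. *)
Lemma forced_arc_range (R : realType) (F : R[i] -> set R[i]) (Q : R[i] -> Prop)
    (p : R[i]) (T : R)
    (g1 g2 : R -> R[i]) (T1 T2 tau1 tau2 : R) :
  forced_arc F Q p p T -> filippov_solution F g1 -> filippov_solution F g2 ->
  0 < T1 -> 0 < T2 ->
  (forall t, g1 (t + T1) = g1 t) -> (forall t, g2 (t + T2) = g2 t) ->
  g1 tau1 = p -> g2 tau2 = p -> range g1 = range g2.
Proof.
move=> [T0 [h [h0 hT _ _ hu]]] s1 s2 T10 T20 g1T g2T g1p g2p.
have at_period g tau : filippov_solution F g -> g tau = p ->
    forall n : nat, g (tau + n%:R * T) = p.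
  move=> sg gp; elim=> [|n IH]; first by rewrite mul0r addr0.
  rewrite -natr1 mulrDl mul1r addrA (hu _ _ sg IH) ?hT//.
  by rewrite lexx ltW.
have agree t : 0 <= t -> g1 (tau1 + t) = g2 (tau2 + t).
  move=> t0; pose n := Num.trunc (t / T); pose u := t - n%:R * T.
  have /andP[nt tn] : n%:R <= t / T < n.+1%:R by apply: truncn_itv; rewrite divr_ge0// ltW.
  rewrite ler_pdivlMr// in nt; rewrite ltr_pdivrMr// -natr1 mulrDl mul1r in tn.
  have uT : 0 <= u <= T by rewrite /u; move: nt tn; clear; lra.
  have tE tau : tau + t = tau + n%:R * T + u by rewrite /u; clear; lra.
  rewrite !tE (hu _ _ s1 (at_period _ _ s1 g1p n) u uT).
  by rewrite (hu _ _ s2 (at_period _ _ s2 g2p n) u uT).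
rewrite (periodic_range tau1 T10 g1T) (periodic_range tau2 T20 g2T).
by apply/seteqP; split=> _ [t t0 <-]; exists t; rewrite // agree.
Qed.

(** * Crossing the line Im z = 1 *)

Lemma solution_climb (R : realType) (F : R[i] -> set R[i]) (g : R -> R[i]) (tau r c : R) :
  filippov_solution F g ->
  (forall t v, tau < t < tau + r -> F (g t) v -> c <= complex.Im v) ->
  forall t, tau < t < tau + r -> c * (t - tau) <= complex.Im (g t) - complex.Im (g tau).
Proof.
move=> [_ acI aeg] Fc t /andP[taut tr].
apply: (absolutely_continuous_ge (f := fun t => complex.Im (g t))) => //; first exact: ltW.
apply: lebesgue_aeS aeg => s [v Fv [_ gI]] /andP[taus st].
by exists (complex.Im v) => //; apply: Fc Fv; rewrite taus (lt_trans st).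
Qed.

Lemma solution_descend (R : realType) (F : R[i] -> set R[i]) (g : R -> R[i]) (tau r c : R) :
  filippov_solution F g ->
  (forall t v, tau < t < tau + r -> F (g t) v -> complex.Im v <= c) ->
  forall t, tau < t < tau + r -> complex.Im (g t) - complex.Im (g tau) <= c * (t - tau).
Proof.
move=> [_ acI aeg] Fc t /andP[taut tr].
apply: (absolutely_continuous_le (f := fun t => complex.Im (g t))) => //; first exact: ltW.
apply: lebesgue_aeS aeg => s [v Fv [_ gI]] /andP[taus st].
by exists (complex.Im v) => //; apply: Fc Fv; rewrite taus (lt_trans st).
Qed.

(** One formula for the three regimes above the lower line: [l = 1] in the upper zone, [l = 0] in
    the strip, the convex parameter on the line. The crossing lemmas need not know in which zone a
    solution moves. *)
Lemma filippov_strip_Im (R : realType) (Xp Xc Xm : R[i] -> R[i]) (z v : R[i]) :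
  -1 < complex.Im z -> filippov_strip Xp Xc Xm z v ->
  exists2 l, 0 <= l <= 1 &
    complex.Im v = l * complex.Im (Xp z) + (1 - l) * complex.Im (Xc z).
Proof.
move=> z1; rewrite /filippov_strip z1.
case: ifP => _; first by move=> ->; exists 1; rewrite ?ler01 ?lexx// mul1r subrr mul0r addr0.
case: ifP => _; last by move=> ->; exists 0; rewrite ?ler01 ?lexx// mul0r subr0 mul1r add0r.
move=> [l /=]; rewrite in_itv/= => l01 <-; exists l => //.
by case: (Xp z) (Xc z) => [? ?] [? ?] /=; rewrite !mul0r !addr0.
Qed.

Lemma strip_near (R : realType) (Xp Xc : R[i] -> R[i]) (g : R -> R[i]) (tau e : R) :
  locally_lipschitz Xp -> locally_lipschitz Xc -> continuous_curve g -> 0 < e ->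
  -1 < complex.Im (g tau) ->
  exists2 r, 0 < r & forall t, tau < t < tau + r -> [/\ -1 < complex.Im (g t),
    `|complex.Im (Xp (g t)) - complex.Im (Xp (g tau))| < e &
    `|complex.Im (Xc (g t)) - complex.Im (Xc (g tau))| < e].
Proof.
move=> lXp lXc cg e0 g1.
have g10 : 0 < complex.Im (g tau) + 1 by move: g1; clear; lra.
have [r r0 H] := curve_near tau cg g10.
have [r1 r10 H1] := curve_near tau (locally_lipschitz_continuous lXp cg) e0.
have [r2 r20 H2] := curve_near tau (locally_lipschitz_continuous lXc cg) e0.
exists (Num.min r (Num.min r1 r2)); first by rewrite !lt_min r0 r10.
move=> t /andP[taut]; rewrite -ltrBlDl !lt_min.
rewrite -[t - tau]ger0_norm ?subr_ge0 ?ltW// => /and3P[tr tr1 tr2]; split.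
- have [_ /ltr_normlP[]] := H t tr; clear; lra.
- by have [] := H1 t tr1.
- by have [] := H2 t tr2.
Qed.

(** Near the point both fields, hence all their convex combinations, have vertical speed at least
    some [c > 0], and the mean value inequality turns this into a climb. *)
Lemma cross_upward (R : realType) (Xp Xc Xm : R[i] -> R[i]) (g : R -> R[i]) (tau : R) :
  locally_lipschitz Xp -> locally_lipschitz Xc ->
  filippov_solution (filippov_strip Xp Xc Xm) g ->
  -1 < complex.Im (g tau) -> 0 < complex.Im (Xp (g tau)) -> 0 < complex.Im (Xc (g tau)) ->
  exists2 r, 0 < r & forall t, tau < t < tau + r -> complex.Im (g tau) < complex.Im (g t).
Proof.
move=> lXp lXc sg g1 p0 c0.
(* Half of the smaller vertical speed: after a perturbation of size [c] each speed is still at least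
   [c]. *)
pose c := Num.min (complex.Im (Xp (g tau)) / 2) (complex.Im (Xc (g tau)) / 2).
have c_gt0 : 0 < c by rewrite lt_min !divr_gt0.
have [cp cc] : c <= complex.Im (Xp (g tau)) / 2 /\ c <= complex.Im (Xc (g tau)) / 2.
  by split; rewrite ge_min lexx ?orbT.
have [r r0 H] := strip_near lXp lXc (solution_continuous sg) c_gt0 g1.
exists r => // t tr.
have /andP[taut _] := tr.
suff : c * (t - tau) <= complex.Im (g t) - complex.Im (g tau).
  by have := mulr_gt0 c_gt0 (ltac:(by rewrite subr_gt0) : 0 < t - tau); clear; lra.
apply: (solution_climb sg _ tr) => s v /H[s1 /ltr_normlP[sp _] /ltr_normlP[sc _]].
move=> /(filippov_strip_Im s1)[l /andP[l0 l1] ->].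
have pc : c <= complex.Im (Xp (g s)) by move: sp cp; clear; lra.
have cc' : c <= complex.Im (Xc (g s)) by move: sc cc; clear; lra.
have l1' : 0 <= 1 - l by rewrite subr_ge0.
by have := ler_wpM2l l0 pc; have := ler_wpM2l l1' cc'; clear; lra.
Qed.

Lemma cross_downward (R : realType) (Xp Xc Xm : R[i] -> R[i]) (g : R -> R[i]) (tau : R) :
  locally_lipschitz Xp -> locally_lipschitz Xc ->
  filippov_solution (filippov_strip Xp Xc Xm) g ->
  -1 < complex.Im (g tau) -> complex.Im (Xp (g tau)) < 0 -> complex.Im (Xc (g tau)) < 0 ->
  exists2 r, 0 < r & forall t, tau < t < tau + r ->
    -1 < complex.Im (g t) < complex.Im (g tau).
Proof.
move=> lXp lXc sg g1 p0 c0.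
pose c := Num.min (- complex.Im (Xp (g tau)) / 2) (- complex.Im (Xc (g tau)) / 2).
have c_gt0 : 0 < c by rewrite lt_min !divr_gt0 ?oppr_gt0.
have [cp cc] : c <= - complex.Im (Xp (g tau)) / 2 /\ c <= - complex.Im (Xc (g tau)) / 2.
  by split; rewrite ge_min lexx ?orbT.
have [r r0 H] := strip_near lXp lXc (solution_continuous sg) c_gt0 g1.
exists r => // t tr.
have /andP[taut _] := tr; have [-> _ _ /=] := H t tr.
suff : complex.Im (g t) - complex.Im (g tau) <= - c * (t - tau).
  by have := mulr_gt0 c_gt0 (ltac:(by rewrite subr_gt0) : 0 < t - tau); clear; lra.
apply: (solution_descend sg _ tr) => s v /H[s1 /ltr_normlP[_ sp] /ltr_normlP[_ sc]].
move=> /(filippov_strip_Im s1)[l /andP[l0 l1] ->].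
have pc : complex.Im (Xp (g s)) <= - c by move: sp cp; clear; lra.
have cc' : complex.Im (Xc (g s)) <= - c by move: sc cc; clear; lra.
have l1' : 0 <= 1 - l by rewrite subr_ge0.
by have := ler_wpM2l l0 pc; have := ler_wpM2l l1' cc'; clear; lra.
Qed.

(** * The fields of the system and their symmetry *)

Definition focus_field (R : realType) (a b x1 : R) (z : R[i]) : R[i] :=
  (a +i* b) * (z - 'i%C + x1%:C).

Definition cubic_field (R : realType) (z : R[i]) : R[i] := 'i%C * z ^+ 3.

Definition system (R : realType) (a b c d x0 x1 : R) : R[i] -> set R[i] :=
  filippov_strip (focus_field a b x1) (@cubic_field R)
    (fun z : R[i] => (c +i* d) * (z + 'i%C - x0%:C)).

Lemma focus_fieldE (R : realType) (a b x1 : R) (z : R[i]) :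
  focus_field a b x1 z =
  (a * (complex.Re z + x1) - b * (complex.Im z - 1)) +i*
  (a * (complex.Im z - 1) + b * (complex.Re z + x1)).
Proof. by case: z => x y; apply: complexP; rewrite /= !subr0 ?addr0. Qed.

Lemma cubic_fieldE (R : realType) (z : R[i]) :
  cubic_field z =
  (complex.Im z ^+ 3 - 3 * complex.Re z ^+ 2 * complex.Im z) +i*
  (complex.Re z ^+ 3 - 3 * complex.Re z * complex.Im z ^+ 2).
Proof. by case: z => x y; apply: complexP => /=; ring. Qed.

Lemma cubic_field_opp (R : realType) (z : R[i]) : cubic_field (- z) = - cubic_field z.
Proof. by rewrite /cubic_field; ring. Qed.

Lemma system_opp (R : realType) (a b c d x0 x1 : R) (z v : R[i]) :
  system a b c d x0 x1 z v -> system c d a b x1 x0 (- z) (- v).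
Proof.
rewrite /system /filippov_strip.
have -> : complex.Im (- z) = - complex.Im z by case: z.
rewrite cubic_field_opp.
have mE : focus_field c d x0 (- z) = - ((c +i* d) * (z + 'i%C - x0%:C)).
  by rewrite /focus_field; ring.
have pE : (a +i* b) * (- z + 'i%C - x1%:C) = - focus_field a b x1 z.
  by rewrite /focus_field; ring.
rewrite mE pE; move: (focus_field a b x1 z) (cubic_field z) (_ * _) => P C M.
(* Reflection exchanges the two sides of a line, so the parameter [l] becomes [1 - l]. *)
have segN u w : segment u w v -> segment (- w) (- u) (- v).
  move=> [l /=]; rewrite in_itv/= => /andP[l0 l1] <-.
  exists (1 - l); first by rewrite /= in_itv/=; move: l0 l1; clear; lra.
  rewrite -![_%:C]/(real_complex R _) !rmorphB/=.
  have -> : (1 : R)%:C = 1 :> R[i] by [].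
  by ring.
move: (complex.Im z) => y.
rewrite [1 < - y]ltrNr [- y == 1]eqr_oppLR [-1 < - y]ltrN2 [- y == -1]eqr_opp.
have lt11 : (1 < -1 :> R) = false by apply/negbTE; rewrite -leNgt; clear; lra.
have eq11 : (1 == -1 :> R) = false by apply/negbTE; rewrite gt_eqF//; clear; lra.
have [y1|y1|->] := ltgtP y 1.
- by have [ym|ym|_] := ltgtP y (-1); [move=> ->|move=> ->|exact: segN].
- have ym : -1 < y by move: y1; clear; lra.
  by rewrite (lt_gtF ym) (gt_eqF ym) => ->.
- by rewrite lt11 eq11; exact: segN.
Qed.

Lemma locally_lipschitz_focus (R : realType) (a b x1 : R) :
  locally_lipschitz (focus_field a b x1).
Proof.
move=> M; exists (`|a| + `|b|); first by rewrite addr_ge0.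
move=> z w _ /=; rewrite !focus_fieldE/=.
set dx := complex.Re z - complex.Re w; set dy := complex.Im z - complex.Im w.
have lin u v : `|u * dx + v * dy| <= (`|u| + `|v|) * (`|dx| + `|dy|).
  apply: (le_trans (ler_normD _ _)); rewrite !normrM mulrDl.
  by rewrite lerD// ler_wpM2l// ?lerDl ?lerDr.
split.
  by have := lin a (- b); rewrite normrN; congr (`|_| <= _); rewrite /dx /dy; ring.
by have := lin b a; rewrite [`|b| + _]addrC; congr (`|_| <= _); rewrite /dx /dy; ring.
Qed.

Lemma locally_lipschitz_cubic (R : realType) : locally_lipschitz (@cubic_field R).
Proof.
(* [6 M ^ 2] bounds every coefficient of [x - x'] and [y - y'] in the two factorisations below, such
   as [- 3 (x y + x' y)]. *)
move=> M; exists (6 * M ^+ 2); first by rewrite mulr_ge0// sqr_ge0.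
move=> z w /=; rewrite !cubic_fieldE/=.
move: (complex.Re z) (complex.Im z) (complex.Re w) (complex.Im w) => x y x' y'.
move=> [xM yM x'M y'M].
have prod u v : `|u| <= M -> `|v| <= M -> - M ^+ 2 <= u * v <= M ^+ 2.
  by move=> uM vM; rewrite -ler_norml normrM expr2 ler_pM.
have lin u v : `|u| <= 6 * M ^+ 2 -> `|v| <= 6 * M ^+ 2 ->
    `|u * (x - x') + v * (y - y')| <= 6 * M ^+ 2 * (`|x - x'| + `|y - y'|).
  move=> uM vM; apply: (le_trans (ler_normD _ _)); rewrite !normrM mulrDr.
  by rewrite lerD// ler_wpM2r.
have M2 : 0 <= M ^+ 2 := sqr_ge0 M.
have sq (u : R) : 0 <= u * u by rewrite -expr2 sqr_ge0.
have := prod _ _ xM xM; have := prod _ _ xM x'M; have := prod _ _ x'M x'M.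
have := prod _ _ yM yM; have := prod _ _ yM y'M; have := prod _ _ y'M y'M.
have := prod _ _ xM yM; have := prod _ _ xM y'M; have := prod _ _ x'M yM.
have := prod _ _ x'M y'M.
have := sq x; have := sq x'; have := sq y; have := sq y'.
move=> *; split.
  have -> : y ^+ 3 - 3 * x ^+ 2 * y - (y' ^+ 3 - 3 * x' ^+ 2 * y') =
    (- 3 * (x * y + x' * y)) * (x - x') +
    (y * y + y * y' + y' * y' - 3 * (x' * x')) * (y - y') by ring.
  by apply: lin; rewrite ler_norml; lra.
have -> : x ^+ 3 - 3 * x * y ^+ 2 - (x' ^+ 3 - 3 * x' * y' ^+ 2) =
    (x * x + x * x' + x' * x' - 3 * (y * y)) * (x - x') +
    (- 3 * (x' * y + x' * y')) * (y - y') by ring.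
by apply: lin; rewrite ler_norml; lra.
Qed.

(** * Trajectories of the two fields *)

Lemma is_derive_add (R : realType) (f g : R -> R) (t df dg : R) :
  is_derive t 1 f df -> is_derive t 1 g dg ->
  is_derive t 1 (fun s => f s + g s) (df + dg).
Proof. by move=> ? ?; exact: is_deriveD. Qed.

Lemma is_derive_mul (R : realType) (f g : R -> R) (t df dg : R) :
  is_derive t 1 f df -> is_derive t 1 g dg ->
  is_derive t 1 (fun s => f s * g s) (df * g t + f t * dg).
Proof.
move=> hf hg; apply: is_derive_eq (is_deriveM hf hg) _.
by rewrite addrC; congr (_ + _); rewrite mulrC.
Qed.

Lemma is_derive_const (R : realType) (t c : R) : is_derive t 1 (fun=> c) (0 : R).
Proof. exact: is_derive_cst. Qed.

Lemma is_derive_affine (R : realType) (t a b : R) :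
  is_derive t 1 (fun s => a + b * s) b.
Proof.
have bt := is_derive_mul (is_derive_const t b) (is_derive_id t 1).
apply: (is_derive_eq (is_derive_add (is_derive_const t a) bt)).
by rewrite mul0r !add0r mulr1.
Qed.

(** The endpoints may lie on discontinuity lines. Hence [J] is demanded at inner times only, [Q]
    separately at both ends, and entry into [J] of every solution that starts at [h 0]. *)
Lemma forced_arc_trajectory (R : realType) (F : R[i] -> set R[i]) (X : R[i] -> R[i])
    (J : set R) (Q : R[i] -> Prop) (h : R -> R[i]) (T : R) :
  0 < T -> locally_lipschitz X -> open J ->
  (forall z, J (complex.Im z) -> F z = [set X z]) -> trajectory X h ->
  (forall t, 0 < t < T -> J (complex.Im (h t))) ->
  (forall g tau, filippov_solution F g -> g tau = h 0 ->
    exists2 r, 0 < r & forall t, tau < t < tau + r -> J (complex.Im (g t))) ->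
  Q (h 0) -> Q (h T) -> (forall t, 0 < t < T -> Q (h t)) ->
  forced_arc F Q (h 0) (h T) T.
Proof.
move=> T0 lX oJ FX Xh hJ enter Q0 QT Qt; split=> //; exists h; split=> //.
  split.
    have [L [hR hI]] := trajectory_lipschitz (ltW T0) lX Xh.
    exists `|L|; first exact: normr_ge0.
    by split; apply: lipschitz_onW (ler_norm L) _.
  by exists [::] => t tT _; exists (X (h t)); [rewrite FX//; exact: hJ|exact: Xh].
  move=> t /andP[]; rewrite !le_eqVlt => /predU1P[<-//|t0] /predU1P[->//|tT].
  by apply: Qt; rewrite t0.
by move=> g tau sg gtau; apply: solution_follows sg lX oJ FX Xh gtau hJ (enter _ _ sg gtau).
Qed.

Lemma sqrt3_lt (R : realType) (x : R) : Num.sqrt 3 < x -> 0 < x /\ 3 < x ^+ 2.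
Proof.
move=> x3; have s30 : 0 <= Num.sqrt 3 :> R := sqrtr_ge0 _.
have x0 := le_lt_trans s30 x3; split=> //.
by rewrite -[3 in X in X < _](sqr_sqrtr (ler0n R 3)) ltr_pXn2r// nnegrE// ltW.
Qed.

(** The vertical speed of the central field on [Im z = 1] is [x (x ^ 2 - 3)], which changes sign at
    sqrt 3. *)
Lemma cubic_field_line_gt0 (R : realType) (x : R) : Num.sqrt 3 < x ->
  0 < x ^+ 3 - 3 * x * 1 ^+ 2.
Proof.
move=> /sqrt3_lt[x0 x3].
have -> : x ^+ 3 - 3 * x * 1 ^+ 2 = x * (x ^+ 2 - 3) by ring.
by rewrite mulr_gt0// subr_gt0.
Qed.

(** Real form of [- x1 + i + rho exp (i theta) exp ((a + i b) t)]. *)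
Definition spiral (R : realType) (a b x1 rho theta t : R) : R[i] :=
  (- x1 + rho * expR (a * t) * cos (theta + b * t)) +i*
  (1 + rho * expR (a * t) * sin (theta + b * t)).

Lemma trajectory_spiral (R : realType) (a b x1 rho theta : R) :
  trajectory (focus_field a b x1) (spiral a b x1 rho theta).
Proof.
move=> t; rewrite /has_velocity focus_fieldE /=.
have de : is_derive t 1 (fun s => rho * expR (a * s)) (a * (rho * expR (a * t))).
  have dat := is_derive_mul (is_derive_const t a) (is_derive_id t 1).
  have dexp := @is_derive1_comp _ expR (fun s => a * s) t _ _ (is_derive_expR _) dat.
  by apply: (is_derive_eq (is_derive_mul (is_derive_const t rho) dexp)); ring.
have dc : is_derive t 1 (fun s => cos (theta + b * s)) (- sin (theta + b * t) * b).
  exact: (@is_derive1_comp _ cos (fun s => theta + b * s) t _ _ _ (is_derive_affine t theta b)).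
have ds : is_derive t 1 (fun s => sin (theta + b * s)) (cos (theta + b * t) * b).
  exact: (@is_derive1_comp _ sin (fun s => theta + b * s) t _ _ _ (is_derive_affine t theta b)).
split.
  by apply: (is_derive_eq (is_derive_add (is_derive_const t (- x1)) (is_derive_mul de dc))); ring.
by apply: (is_derive_eq (is_derive_add (is_derive_const t 1) (is_derive_mul de ds))); ring.
Qed.

(** The angle [theta + b t] reaches pi at time [(pi - theta) / b], when the spiral meets the line to
    the left of the focus. With [theta = 0] it starts on the line, where upward crossing needs the
    abscissa [rho - x1] beyond sqrt 3; with [theta > 0] it starts strictly above. *)
Lemma spiral_arc (R : realType) (a b c d x0 x1 rho theta : R) (Q : R[i] -> Prop) :
  0 < b -> 0 < rho -> 0 <= theta < pi ->
  (theta = 0 -> Num.sqrt 3 < rho - x1) ->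
  Q ((rho * cos theta - x1) +i* (1 + rho * sin theta)) ->
  Q ((- (x1 + rho * expR (a * ((pi - theta) / b)))) +i* 1) ->
  (forall z, 1 < complex.Im z -> Q z) ->
  forced_arc (system a b c d x0 x1) Q
    ((rho * cos theta - x1) +i* (1 + rho * sin theta))
    ((- (x1 + rho * expR (a * ((pi - theta) / b)))) +i* 1) ((pi - theta) / b).
Proof.
move=> b0 rho0 /andP[theta0 thetapi] cross Q0 QT Qup.
have T0 : 0 < (pi - theta) / b by rewrite divr_gt0// subr_gt0.
have E0 : (rho * cos theta - x1) +i* (1 + rho * sin theta) = spiral a b x1 rho theta 0.
  by rewrite /spiral !mulr0 !addr0 expR0 mulr1 addrC.
have ET : (- (x1 + rho * expR (a * ((pi - theta) / b)))) +i* 1 =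
    spiral a b x1 rho theta ((pi - theta) / b).
  have bT : b * ((pi - theta) / b) = pi - theta by rewrite mulrC divfK ?gt_eqF.
  rewrite /spiral bT addrCA subrr addr0 cospi sinpi.
  by rewrite mulr0 addr0 mulrN1 opprD.
have up t : 0 < t < (pi - theta) / b -> 1 < complex.Im (spiral a b x1 rho theta t).
  move=> /andP[t0 tT] /=; rewrite ltrDl mulr_gt0 ?mulr_gt0 ?expR_gt0//.
  apply: sin_gt0_pi; rewrite ltr_wpDl ?mulr_gt0//=.
  by rewrite -ltrBrDl mulrC -ltr_pdivlMr.
rewrite E0 ET in Q0 QT *.
apply: (@forced_arc_trajectory _ _ (focus_field a b x1) [set y | 1 < y]) => //.
- exact: locally_lipschitz_focus.
- by move=> z /= z1; rewrite /system /filippov_strip z1.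
- exact: trajectory_spiral.
- move=> g tau sg g0 /=.
  have [t0|tn0] := eqVneq theta 0.
    have x3 := cross t0.
    have gE : g tau = (rho - x1) +i* 1.
      by rewrite g0 t0 /spiral !mulr0 addr0 expR0 cos0 sin0 mulr0 !mulr1 addr0 addrC.
    have [|||r r0 Hr] := cross_upward (tau := tau) (locally_lipschitz_focus a b x1)
      (@locally_lipschitz_cubic R) sg.
    - by rewrite gE/=; clear; lra.
    - by rewrite gE focus_fieldE/= subrr mulr0 add0r subrK mulr_gt0.
    - by rewrite gE cubic_fieldE/=; exact: cubic_field_line_gt0.
    - by exists r => // t /Hr; rewrite gE.
  have gI : 0 < complex.Im (g tau) - 1.
    rewrite g0 /= !mulr0 !addr0 expR0 mulr1 addrAC subrr add0r mulr_gt0// sin_gt0_pi//.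
    by rewrite thetapi lt_neqAle eq_sym tn0 theta0.
  have [r r0 Hr] := curve_near tau (solution_continuous sg) gI.
  exists r => // t /andP[taut tr].
  have [|_ /ltr_normlP[]] := Hr t; last by clear; lra.
  by rewrite gtr0_norm ?subr_gt0// ltrBlDl.
- by move=> t /up/Qup.
Qed.

(** * The central flow in the coordinate 1 / z ^ 2 *)

Definition cubic_invariant (R : realType) (x y : R) : R :=
  (x ^+ 2 - y ^+ 2) / (x ^+ 2 + y ^+ 2) ^+ 2.

(** Imaginary part of [1 / z ^ 2], of which [cubic_invariant] is the real part; it decreases at rate
    2 along the central field. *)
Definition cubic_phase (R : realType) (x y : R) : R :=
  - (2 * x * y) / (x ^+ 2 + y ^+ 2) ^+ 2.

(** For [1 / z ^ 2 = k + i m] this is [1 / |z| ^ 2]. *)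
Definition cubic_modulus (R : realType) (k m : R) : R := Num.sqrt (k ^+ 2 + m ^+ 2).

(** Real part of the principal square root of [k + i m]. *)
Definition cubic_root (R : realType) (k m : R) : R :=
  Num.sqrt ((cubic_modulus k m + k) / 2).

(* The root of 1 / z ^ 2 = k + i m that has negative real part. *)
Definition cubic_point (R : realType) (k m : R) : R[i] :=
  (- (cubic_root k m / cubic_modulus k m)) +i*
  (m / (2 * cubic_root k m * cubic_modulus k m)).

Lemma cubic_modulus_gt0 (R : realType) (k m : R) : 0 < k -> 0 < cubic_modulus k m.
Proof. by move=> k0; rewrite sqrtr_gt0 ltr_wpDr ?sqr_ge0// exprn_gt0. Qed.

Lemma cubic_modulus_sqr (R : realType) (k m : R) :
  cubic_modulus k m ^+ 2 = k ^+ 2 + m ^+ 2.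
Proof. by rewrite sqr_sqrtr// addr_ge0// sqr_ge0. Qed.

Lemma cubic_root_gt0 (R : realType) (k m : R) : 0 < k -> 0 < cubic_root k m.
Proof.
by move=> k0; rewrite sqrtr_gt0 divr_gt0// addr_gt0// cubic_modulus_gt0.
Qed.

Lemma cubic_root_sqr (R : realType) (k m : R) : 0 < k ->
  cubic_root k m ^+ 2 = (cubic_modulus k m + k) / 2.
Proof.
by move=> k0; rewrite sqr_sqrtr// divr_ge0// addr_ge0 ?ltW// cubic_modulus_gt0.
Qed.

(** If [A + i B] is the square root of [k + i m], then [m = 2 A B] and [A ^ 2 + B ^ 2] is the
    modulus. The identity eliminates [m ^ 2] from rational expressions. *)
Lemma cubic_phase_sqr (R : realType) (k m : R) : 0 < k ->
  m ^+ 2 = 4 * cubic_root k m ^+ 2 * (cubic_modulus k m - cubic_root k m ^+ 2).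
Proof.
move=> k0; have := cubic_modulus_sqr k m; rewrite cubic_root_sqr//.
by move: (cubic_modulus k m) => s s2; rewrite -[LHS](addKr (k ^+ 2)) -s2; field.
Qed.

(** From [(1 / z ^ 2)' = - 2 z' / z ^ 3 = - 2 i], [k] is constant and [m] is affine with slope -2.
    The check differentiates the explicit square roots and ends in rational identities in [m], [s]
    and [A], closed by [cubic_phase_sqr]. *)
Lemma trajectory_cubic (R : realType) (k m0 : R) : 0 < k ->
  trajectory (@cubic_field R) (fun t => cubic_point k (m0 + -2 * t)).
Proof.
move=> k0 t; rewrite /has_velocity cubic_fieldE /=.
have dm := is_derive_affine t m0 (-2).
set m := m0 + -2 * t.
have s0 := cubic_modulus_gt0 m k0; have A0 := cubic_root_gt0 m k0.
have m2 := cubic_phase_sqr m k0.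
have sE : cubic_modulus k m != 0 by rewrite gt_eqF.
have AE : cubic_root k m != 0 by rewrite gt_eqF.
have ds : is_derive t 1 (fun u => cubic_modulus k (m0 + -2 * u))
    (- 2 * m / cubic_modulus k m).
  have dq := is_derive_add (is_derive_const t (k ^+ 2)) (is_derive_mul dm dm).
  have pos : 0 < k ^+ 2 + m * m by rewrite -expr2 ltr_wpDr ?sqr_ge0// exprn_gt0.
  have := @is_derive1_comp _ (@Num.sqrt R) (fun u => k ^+ 2 + (m0 + -2 * u) * (m0 + -2 * u))
    t _ _ (is_derive1_sqrt pos) dq.
  rewrite -expr2 -/(cubic_modulus k m) => h; apply: (is_derive_eq h).
  by rewrite -/m; field.
have dA : is_derive t 1 (fun u => cubic_root k (m0 + -2 * u))
    (- m / (2 * cubic_modulus k m * cubic_root k m)).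
  have dq := is_derive_mul (is_derive_add ds (is_derive_const t k)) (is_derive_const t 2^-1).
  have pos : 0 < (cubic_modulus k m + k) / 2 by rewrite divr_gt0// addr_gt0.
  have := @is_derive1_comp _ (@Num.sqrt R) (fun u => (cubic_modulus k (m0 + -2 * u) + k) / 2)
    t _ _ (is_derive1_sqrt pos) dq.
  rewrite -/(cubic_root k m) => h; apply: (is_derive_eq h).
  by field; rewrite ?sE ?AE.
have dsV := @is_deriveV _ (fun u => cubic_modulus k (m0 + -2 * u)) t _ _ sE ds.
have d2 := is_derive_const t (2 : R).
have d2As := is_derive_mul (is_derive_mul d2 dA) ds.
have As0 : 2 * cubic_root k m * cubic_modulus k m != 0 by rewrite !mulf_neq0.
move: m2 sE AE; rewrite -/m.
set s := cubic_modulus k m; set A := cubic_root k m => m2 sE AE; split.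
  apply: (is_derive_eq (is_deriveN (is_derive_mul dA dsV))).
  rewrite -/m -/s -/A -[_ *: _]/(_ * _).
  have -> : (m / (2 * A * s)) ^+ 3 = m * m ^+ 2 / (8 * A ^+ 3 * s ^+ 3) by field; rewrite ?sE ?AE.
  by rewrite m2; field; rewrite ?sE ?AE.
have dV := @is_deriveV _ (fun u => 2 * cubic_root k (m0 + -2 * u) *
  cubic_modulus k (m0 + -2 * u)) t _ _ As0 d2As.
apply: (is_derive_eq (is_derive_mul dm dV)).
rewrite -/m -/s -/A -[_ *: _]/(_ * _).
have -> : -2 / (2 * A * s) + m * (- (2 * A * s) ^- 2 *
   ((0 * A + 2 * (- m / (2 * s * A))) * s + 2 * A * (- 2 * m / s))) =
  (- 4 * A ^+ 2 * s ^+ 2 + m ^+ 2 * s + 4 * m ^+ 2 * A ^+ 2) / (4 * A ^+ 3 * s ^+ 3).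
  by field; rewrite ?sE ?AE.
have -> : (- (A / s)) ^+ 3 - 3 * - (A / s) * (m / (2 * A * s)) ^+ 2 =
  (- 4 * A ^+ 4 + 3 * m ^+ 2) / (4 * A * s ^+ 3) by field; rewrite ?sE ?AE.
by rewrite m2; field; rewrite ?sE ?AE.
Qed.

Lemma cubic_point_Im (R : realType) (k m : R) : 0 < k ->
  complex.Im (cubic_point k m) ^+ 2 =
  (cubic_modulus k m - k) / (2 * cubic_modulus k m ^+ 2).
Proof.
move=> k0 /=; have s0 : cubic_modulus k m != 0 by rewrite gt_eqF// cubic_modulus_gt0.
have A0 : cubic_root k m != 0 by rewrite gt_eqF// cubic_root_gt0.
have -> : (m / (2 * cubic_root k m * cubic_modulus k m)) ^+ 2 =
  m ^+ 2 / (4 * cubic_root k m ^+ 2 * cubic_modulus k m ^+ 2) by field; rewrite ?s0 ?A0.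
have -> : cubic_modulus k m - k = 2 * (cubic_modulus k m - cubic_root k m ^+ 2).
  by rewrite cubic_root_sqr//; field.
by rewrite (cubic_phase_sqr m k0); field; rewrite ?s0 ?A0.
Qed.

Lemma cubic_pointE (R : realType) (x y : R) : x < 0 -> y ^+ 2 < x ^+ 2 ->
  cubic_point (cubic_invariant x y) (cubic_phase x y) = x +i* y.
Proof.
move=> x0 yx.
have n0 : 0 < x ^+ 2 + y ^+ 2.
  by rewrite (le_lt_trans (sqr_ge0 y))// (lt_le_trans yx)// lerDl sqr_ge0.
have nE : x ^+ 2 + y ^+ 2 != 0 by rewrite gt_eqF.
have xE : x != 0 by rewrite lt_eqF.
have sE : cubic_modulus (cubic_invariant x y) (cubic_phase x y) = (x ^+ 2 + y ^+ 2)^-1.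
  rewrite /cubic_modulus /cubic_invariant /cubic_phase.
  rewrite (_ : _ + _ = (x ^+ 2 + y ^+ 2)^-1 ^+ 2); last by field.
  by rewrite sqrtr_sqr ger0_norm// invr_ge0 ltW.
have AE : cubic_root (cubic_invariant x y) (cubic_phase x y) = - x / (x ^+ 2 + y ^+ 2).
  rewrite /cubic_root sE /cubic_invariant.
  rewrite (_ : _ / 2 = (- x / (x ^+ 2 + y ^+ 2)) ^+ 2); last by field.
  by rewrite sqrtr_sqr ger0_norm//; apply: divr_ge0; [rewrite oppr_ge0|]; exact: ltW.
rewrite /cubic_point sE AE /cubic_phase; congr (_ +i* _); field; rewrite ?xE nE//.
Qed.

Lemma cubic_modulus_phase (R : realType) (x y : R) : 0 < x ^+ 2 + y ^+ 2 ->
  cubic_invariant x y ^+ 2 + cubic_phase x y ^+ 2 = (x ^+ 2 + y ^+ 2)^-1 ^+ 2.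
Proof.
by move=> n0; rewrite /cubic_invariant /cubic_phase; field; rewrite gt_eqF.
Qed.

(** In [S = 1 / (w ^ 2 + 1)] the invariant on the line is the parabola [S - 2 S ^ 2], with vertex at
    [S = 1 / 4], that is [w = sqrt 3]; for [w > sqrt 3] one is on its increasing branch. *)
Lemma cubic_invariant_line (R : realType) (w : R) : cubic_invariant w 1 =
  (w ^+ 2 + 1)^-1 - 2 * (w ^+ 2 + 1)^-1 ^+ 2.
Proof.
have n0 : 0 < w ^+ 2 + 1 by rewrite ltr_wpDl ?sqr_ge0.
by rewrite /cubic_invariant expr1n; field; rewrite gt_eqF.
Qed.

(* A point with |z| > 2 and cubic invariant below 1/8, the maximum of the
   invariant on the line Im z = 1, lies on a level curve that crosses this line
   at abscissas of modulus greater than sqrt 3. *)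
Definition outer (R : realType) (x y : R) : Prop :=
  4 < x ^+ 2 + y ^+ 2 /\ 8 * (x ^+ 2 - y ^+ 2) < (x ^+ 2 + y ^+ 2) ^+ 2.

(** The phase falls from its initial value to that of [w + i], which is also that of [- w - i]; the
    inequality [<=] admits the start [- w + i], of opposite phase. In between the phase is smaller
    in absolute value, so [|z| ^ 2] exceeds [w ^ 2 + 1], and this keeps the curve in the strip and
    in [outer]. *)
Lemma center_arc (R : realType) (a b c d x0 x1 x y w : R) (Q : R[i] -> Prop) :
  let F := system a b c d x0 x1 in
  x < 0 -> y ^+ 2 < x ^+ 2 -> Num.sqrt 3 < w ->
  cubic_invariant x y = cubic_invariant w 1 ->
  cubic_phase w 1 < cubic_phase x y <= - cubic_phase w 1 ->
  (forall g tau, filippov_solution F g -> g tau = x +i* y ->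
    exists2 r, 0 < r & forall t, tau < t < tau + r -> -1 < complex.Im (g t) < 1) ->
  Q (x +i* y) -> Q ((- w) +i* (- 1)) ->
  (forall u v, -1 < v < 1 -> outer u v -> Q (u +i* v)) ->
  exists T, forced_arc F Q (x +i* y) ((- w) +i* (- 1)) T.
Proof.
move=> F x_lt0 yx w3 kE /andP[m1 m2] enter Qp Qq Qin.
have [w0 w23] := sqrt3_lt w3.
have wN : (- w) ^+ 2 = w ^+ 2 by rewrite sqrrN.
have kN : cubic_invariant (- w) (- 1) = cubic_invariant w 1.
  by rewrite /cubic_invariant !sqrrN.
have MN : cubic_phase (- w) (- 1) = cubic_phase w 1.
  by rewrite /cubic_phase !sqrrN; congr (- _ / _); ring.
have w1 : 1 < w ^+ 2 by apply: lt_trans w23; rewrite ltr1n.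
have n0 : 0 < w ^+ 2 + 1 by rewrite addr_gt0// exprn_gt0.
have n0' : 0 < w ^+ 2 + 1 ^+ 2 by rewrite expr1n.
have kM := cubic_modulus_phase n0'; rewrite expr1n in kM.
have kline := cubic_invariant_line w.
have startE : cubic_point (cubic_invariant w 1) (cubic_phase x y) = x +i* y.
  by rewrite -kE cubic_pointE.
have endE : cubic_point (cubic_invariant w 1) (cubic_phase w 1) = (- w) +i* (- 1).
  by rewrite -kN -MN cubic_pointE ?oppr_lt0// !sqrrN expr1n.
have k0 : 0 < cubic_invariant w 1.
  by rewrite /cubic_invariant expr1n divr_gt0 ?subr_gt0// exprn_gt0.
have S4 : (w ^+ 2 + 1)^-1 < 4^-1.
  by rewrite ltf_pV2 ?posrE//; move: w23; clear; lra.
have S0 : 0 < (w ^+ 2 + 1)^-1 by rewrite invr_gt0.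
move: (cubic_invariant w 1) (cubic_phase w 1) (cubic_phase x y) (w ^+ 2 + 1)^-1
  m1 m2 startE endE k0 kM kline S4 S0 => k M m0 S m1 m2 startE endE k0 kM kline S4 S0.
clear kE kN MN n0 n0' w1 wN.
(* The total drop of the phase divided by its rate 2. *)
pose T := (m0 - M) / 2; exists T.
have T0 : 0 < T by rewrite divr_gt0// subr_gt0.
have E0 : x +i* y = cubic_point k (m0 + -2 * 0) by rewrite mulr0 addr0.
have ET : (- w) +i* (- 1) = cubic_point k (m0 + -2 * T).
  by rewrite (_ : m0 + _ = M) // /T; field.
have inside t : 0 < t < T -> -1 < complex.Im (cubic_point k (m0 + -2 * t)) < 1 /\
    outer (complex.Re (cubic_point k (m0 + -2 * t)))
          (complex.Im (cubic_point k (m0 + -2 * t))).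
  move=> /andP[t0 tT]; rewrite -ltr_norml /outer.
  have mM : (m0 + -2 * t) ^+ 2 < M ^+ 2.
    have [mM1 mM2] : M - (m0 + -2 * t) < 0 /\ M + (m0 + -2 * t) < 0.
      by move: t0 tT m2; rewrite /T; clear; split; lra.
    by rewrite -subr_gt0 subr_sqr nmulr_rgt0.
  have -> : complex.Re (cubic_point k (m0 + -2 * t)) ^+ 2 =
      (cubic_modulus k (m0 + -2 * t) + k) / (2 * cubic_modulus k (m0 + -2 * t) ^+ 2).
    rewrite /= sqrrN expr_div_n cubic_root_sqr//; field.
    by rewrite gt_eqF// cubic_modulus_gt0.
  rewrite -[`|_| < 1](ltr_pXn2r (n := 2)) ?nnegrE// expr1n real_normK ?num_real//.
  rewrite cubic_point_Im//.
  have := cubic_modulus_sqr k (m0 + -2 * t); have := cubic_modulus_gt0 (m0 + -2 * t) k0.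
  move: (cubic_modulus k _) => s s0 s2.
  have sS : s < S by rewrite -(ltr_pXn2r (n := 2)) ?nnegrE ?ltW// s2 -kM ltrD2l.
  have sE : s != 0 by rewrite gt_eqF.
  rewrite (_ : (s + k) / _ + _ = s^-1); last by field.
  rewrite (_ : (s + k) / _ - _ = k * s^-1 ^+ 2); last by field.
  split.
    rewrite ltr_pdivrMr ?mulr_gt0 ?exprn_gt0// mul1r kline.
    (* With [k = S - 2 S ^ 2], this product is [2 s ^ 2 - (s - k)]; it is positive as
       [s < S < 1 / 4]. *)
    have : 0 < (S - s) * (1 - 2 * (s + S)).
      by apply: mulr_gt0; move: sS S4 s0; clear; lra.
    by rewrite !expr2; clear; lra.
  split; first by rewrite -[4]invrK ltf_pV2 ?posrE// (lt_trans sS).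
  rewrite mulrA gtr_pMl ?exprn_gt0 ?invr_gt0// kline.
  (* This square equals [1 - 8 k]. *)
  have : 0 < (1 - 4 * S) ^+ 2 by rewrite exprn_gt0// subr_gt0; move: S4; clear; lra.
  by rewrite !expr2; clear; lra.
rewrite E0 ET in Qp Qq *.
apply: (@forced_arc_trajectory _ _ (@cubic_field R) [set` `]-1, 1[] Q
  (fun t => cubic_point k (m0 + -2 * t))).
- exact: T0.
- exact: locally_lipschitz_cubic.
- exact: interval_open.
- move=> z /=; rewrite in_itv/= => /andP[z1 z2].
  by rewrite /F /system /filippov_strip z1 (lt_eqF z2) (lt_gtF z2).
- exact: trajectory_cubic.
- by move=> t /inside[]; rewrite /= in_itv.
- move=> g tau sg; rewrite mulr0 addr0 startE => /(enter g tau sg)[r r0 Hr].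
  by exists r => // t /Hr; rewrite /= in_itv.
- exact: Qp.
- exact: Qq.
- by move=> t /inside[? ?]; exact: Qin.
Qed.

(** * The return map and its domain *)

(** The second inequality amounts to [(w ^ 2 - 3) ^ 2 > 0]. *)
Lemma outer_line (R : realType) (w : R) : Num.sqrt 3 < w -> outer w 1.
Proof.
move=> /sqrt3_lt[_ w3]; rewrite /outer expr1n; split; first by move: w3; clear; lra.
have : 0 < (w ^+ 2 - 3) ^+ 2 by rewrite exprn_gt0// subr_gt0.
by rewrite !expr2; clear; lra.
Qed.

(* An open set, containing the cycle, from which every solution reaches a point
   of the form x + i or - (x + i) with x > sqrt 3; it avoids the escaping
   segments, where solutions are not determined by their initial point. *)
Definition good (R : realType) (x0 x1 : R) (z : R[i]) : Prop :=
  let x := complex.Re z in let y := complex.Im z in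
  [\/ 1 < y, y < -1,
      [/\ outer x y, -1 < y & [\/ y < 1, Num.sqrt 3 < x | x < - x1]] |
      [/\ outer x y, y < 1 & [\/ -1 < y, x < - Num.sqrt 3 | x0 < x]]].

Lemma outerNl (R : realType) (x y : R) : outer x y -> outer (- x) y.
Proof. by rewrite /outer sqrrN. Qed.

Lemma outerNr (R : realType) (x y : R) : outer x y -> outer x (- y).
Proof. by rewrite /outer sqrrN. Qed.

Lemma good_opp (R : realType) (x0 x1 : R) (z : R[i]) : good x0 x1 z -> good x1 x0 (- z).
Proof.
case: z => x y; rewrite /good /=.
move=> [y1|y1|[oxy y1 H]|[oxy y1 H]].
- by apply: Or42; rewrite ltrN2.
- by apply: Or41; rewrite ltrNr.
- apply: Or44; split; [exact/outerNl/outerNr|by rewrite ltrNl|].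
  case: H => H; [apply: Or31|apply: Or32|apply: Or33].
  + by rewrite ltrN2.
  + by rewrite ltrN2.
  + by rewrite ltrNr.
- apply: Or43; split; [exact/outerNl/outerNr|by rewrite ltrN2|].
  case: H => H; [apply: Or31|apply: Or32|apply: Or33].
  + by rewrite ltrNl.
  + by rewrite ltrNr.
  + by rewrite ltrN2.
Qed.

(** At [- w + i] the focus field points down because [w > x1], the central field because
    [w > sqrt 3]; the phase starts at the largest value that [center_arc] admits. *)
Lemma left_arc (R : realType) (a b c d x0 x1 w : R) :
  0 < b -> Num.sqrt 3 < w -> x1 < w ->
  exists T, forced_arc (system a b c d x0 x1) (good x0 x1) ((- w) +i* 1) ((- w) +i* (- 1)) T.
Proof.
move=> b0 w3 x1w; have [w0 w23] := sqrt3_lt w3.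
have phaseN : cubic_phase (- w) 1 = - cubic_phase w 1.
  by rewrite /cubic_phase sqrrN; ring.
have phase_lt0 : cubic_phase w 1 < 0.
  by rewrite /cubic_phase mulNr oppr_lt0 divr_gt0 ?exprn_gt0 ?mulr_gt0// addr_gt0// exprn_gt0.
apply: center_arc => //.
- by rewrite oppr_lt0.
- by rewrite sqrrN expr1n; move: w23; clear; lra.
- by rewrite /cubic_invariant sqrrN.
- by rewrite phaseN lexx andbT; move: phase_lt0; clear; lra.
- move=> g tau sg gE.
  have [|||r r0 Hr] := cross_downward (tau := tau) (locally_lipschitz_focus a b x1)
      (@locally_lipschitz_cubic R) sg.
  + by rewrite gE/=; clear; lra.
  + by rewrite gE focus_fieldE/= subrr mulr0 add0r pmulr_rlt0//; move: x1w; clear; lra.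
  + rewrite gE cubic_fieldE/=; have := cubic_field_line_gt0 w3.
    by rewrite exprNn mulrN mulNr -signr_odd/= !expr1 mulN1r; clear; lra.
  + by exists r => // t /Hr; rewrite gE.
- apply: Or43; split=> /=; [exact/outerNl/outer_line|by clear; lra|].
  by apply: Or33; rewrite ltrN2.
- apply: Or44; split=> /=; [exact/outerNl/outerNr/outer_line|by clear; lra|].
  by apply: Or32; rewrite ltrN2.
- by move=> u v /andP[v1 v2] ouv; apply: Or43; split=> //; apply: Or31.
Qed.

(** Half a turn ends on the reflected section, so the other half is the same result for the
    exchanged parameters. *)
Lemma half_arc (R : realType) (a b c d x0 x1 x : R) :
  0 < b -> Num.sqrt 3 < x1 -> Num.sqrt 3 < x ->
  exists T, forced_arc (system a b c d x0 x1) (good x0 x1) (x +i* 1)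
    (- ((x1 + (x + x1) * expR (a * (pi / b))) +i* 1)) T.
Proof.
move=> b0 x13 x3; have [x1_gt0 _] := sqrt3_lt x13; have [x_gt0 _] := sqrt3_lt x3.
have rho0 : 0 < x + x1 by rewrite addr_gt0.
have := @spiral_arc R a b c d x0 x1 (x + x1) 0 (good x0 x1) b0 rho0.
rewrite lexx pi_gt0 cos0 sin0 mulr1 mulr0 addr0 subr0 addrK => /(_ isT (fun=> x3)).
set w := x1 + _.
have x1w : x1 < w by rewrite ltrDl mulr_gt0// expR_gt0.
have w3 := lt_trans x13 x1w.
move=> up.
have {}up : forced_arc (system a b c d x0 x1) (good x0 x1) (x +i* 1) ((- w) +i* 1) (pi / b).
  apply: up; last by move=> z z1; apply: Or41.
    apply: Or43; split=> /=; [exact: outer_line|by clear; lra|exact: Or32].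
  apply: Or43; split=> /=; [exact/outerNl/outer_line|by clear; lra|].
  by apply: Or33; rewrite ltrN2.
have [T down] := @left_arc R a b c d x0 x1 w b0 w3 x1w.
by exists (pi / b + T); exact: forced_arc_trans up down.
Qed.

Definition half_map (R : realType) (a b x1 x : R) : R :=
  x1 + (x + x1) * expR (a * (pi / b)).

Lemma half_arc_lower (R : realType) (a b c d x0 x1 x : R) :
  0 < d -> Num.sqrt 3 < x0 -> Num.sqrt 3 < x ->
  exists T, forced_arc (system a b c d x0 x1) (good x0 x1)
    (- (x +i* 1)) (half_map c d x0 x +i* 1) T.
Proof.
move=> d0 x03 x3; have [T arcT] := @half_arc R c d a b x1 x0 x d0 x03 x3.
exists T; rewrite -[X in forced_arc _ _ _ X]opprK.
apply: forced_arc_opp (@good_opp _ _ _) arcT.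
  exact: (@system_opp R c d a b x1 x0).
exact: (@system_opp R a b c d x0 x1).
Qed.

Lemma half_map_gt (R : realType) (a b x1 x : R) :
  Num.sqrt 3 < x1 -> Num.sqrt 3 < x -> Num.sqrt 3 < half_map a b x1 x.
Proof.
move=> x13 x3; have [x1_gt0 _] := sqrt3_lt x13; have [x_gt0 _] := sqrt3_lt x3.
by rewrite (lt_trans x13)// ltrDl mulr_gt0 ?expR_gt0// addr_gt0.
Qed.

Lemma return_arc (R : realType) (a b c d x0 x1 x : R) :
  0 < b -> 0 < d -> Num.sqrt 3 < x0 -> Num.sqrt 3 < x1 -> Num.sqrt 3 < x ->
  exists T, forced_arc (system a b c d x0 x1) (good x0 x1) (x +i* 1)
    (half_map c d x0 (half_map a b x1 x) +i* 1) T.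
Proof.
move=> b0 d0 x03 x13 x3.
have [T1 arc1] := @half_arc R a b c d x0 x1 x b0 x13 x3.
have [T2 arc2] := @half_arc_lower R a b c d x0 x1 _ d0 x03 (half_map_gt a b x13 x3).
by exists (T1 + T2); exact: forced_arc_trans arc1 arc2.
Qed.

(** * Points from which every solution reaches the section *)

Lemma polar (R : realType) (u v : R) : 0 < v ->
  exists rho theta, [/\ 0 < rho, 0 < theta < pi, u = rho * cos theta & v = rho * sin theta].
Proof.
move=> v0; have r20 : 0 < u ^+ 2 + v ^+ 2 by rewrite ltr_wpDl ?sqr_ge0// exprn_gt0.
pose rho := Num.sqrt (u ^+ 2 + v ^+ 2).
have rho0 : 0 < rho by rewrite sqrtr_gt0.
have rho2 : rho ^+ 2 = u ^+ 2 + v ^+ 2 by rewrite sqr_sqrtr// ltW.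
have ur : -1 < u / rho < 1.
  rewrite -ltr_norml -(ltr_pXn2r (n := 2)) ?nnegrE// expr1n real_normK ?num_real//.
  by rewrite expr_div_n rho2 ltr_pdivrMr// mul1r ltrDl exprn_gt0.
have /andP[ur1 ur2] := ur.
exists rho, (acos (u / rho)); split=> //.
- by rewrite acos_gt0 ?acos_ltpi// ?ur1 ?ur2 ?ltW.
- rewrite acosK; first by rewrite mulrC divfK ?gt_eqF.
  by rewrite in_itv/= !ltW.
- rewrite sin_acos ?ltW//.
  rewrite (_ : 1 - _ = (v / rho) ^+ 2); last first.
    by rewrite !expr_div_n rho2; field; rewrite gt_eqF.
  by rewrite sqrtr_sqr ger0_norm ?divr_ge0 ?ltW// mulrC divfK ?gt_eqF.
Qed.

Lemma outer_center_arc (R : realType) (a b c d x0 x1 x y : R) :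
  -1 < y < 1 -> x < 0 -> outer x y ->
  exists T w, Num.sqrt 3 < w /\
    forced_arc (system a b c d x0 x1) (fun=> True) (x +i* y) (- (w +i* 1)) T.
Proof.
move=> y1 x_lt0 [n4 inv8].
have y2 : y ^+ 2 < 1 by rewrite -(expr1n _ 2) -real_normK ?num_real// ltr_pXn2r ?nnegrE// ltr_norml.
have yx : y ^+ 2 < x ^+ 2 by move: n4 y2; clear; lra.
have n0 : 0 < x ^+ 2 + y ^+ 2 by move: n4; clear; lra.
set n := x ^+ 2 + y ^+ 2 in n4 inv8 n0.
set k := cubic_invariant x y.
have k0 : 0 < k by rewrite /k /cubic_invariant divr_gt0 ?subr_gt0 ?exprn_gt0.
have k8 : 8 * k < 1 by rewrite /k /cubic_invariant mulrA ltr_pdivrMr ?exprn_gt0// mul1r.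
(* [S] is the smaller root of [S - 2 S ^ 2 = k], real because [8 k < 1]; it lies below 1/4, hence
   equals [1 / (w ^ 2 + 1)] for some [w > sqrt 3]. *)
pose q := Num.sqrt (1 - 8 * k); pose S := (1 - q) / 4.
have q2 : q ^+ 2 = 1 - 8 * k by rewrite sqr_sqrtr// subr_ge0 ltW.
have q0 : 0 < q by rewrite sqrtr_gt0 subr_gt0.
have q1 : q < 1 by rewrite -(ltr_pXn2r (n := 2)) ?nnegrE ?ltW// q2 expr1n; move: k0; clear; lra.
have S0 : 0 < S by rewrite divr_gt0// subr_gt0.
have S4 : S < 4^-1 by move: q0; rewrite /S; clear; lra.
have kS : k = S - 2 * S ^+ 2.
  have -> : k = (1 - q ^+ 2) / 8 by rewrite q2; field.
  by rewrite /S; field.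
have wS : 3 < S^-1 - 1 by have := S4; rewrite -ltf_pV2 ?posrE ?invr_gt0// invrK; clear; lra.
pose w := Num.sqrt (S^-1 - 1).
have w0 : 0 < S^-1 - 1 by move: wS; clear; lra.
have w2 : w ^+ 2 = S^-1 - 1 by rewrite sqr_sqrtr// ltW.
have w3 : Num.sqrt 3 < w by rewrite ltr_sqrt.
have w_gt0 : 0 < w by rewrite sqrtr_gt0.
have kw : cubic_invariant x y = cubic_invariant w 1.
  by rewrite cubic_invariant_line w2 subrK invrK -kS.
have nw : 0 < w ^+ 2 + 1 ^+ 2 by rewrite expr1n w2 subrK invr_gt0.
have kMw := cubic_modulus_phase nw; have kM := cubic_modulus_phase n0.
rewrite expr1n w2 subrK invrK -kw in kMw.
have s4 : n^-1 < 4^-1 by rewrite ltf_pV2 ?posrE.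
have s0 : 0 < n^-1 by rewrite invr_gt0.
(* [|y| < 1] gives [1 / n - 2 / n ^ 2 < k = S - 2 S ^ 2], and both [1 / n] and [S] lie below 1/4,
   where this parabola increases. *)
have sS : n^-1 < S.
  have sk : n^-1 - k < 2 * n^-1 ^+ 2.
    rewrite (_ : n^-1 - k = 2 * y ^+ 2 * n^-1 ^+ 2); last first.
      by rewrite /k /cubic_invariant -/n /n; field; rewrite gt_eqF.
    by rewrite ltr_pM2r ?exprn_gt0//; move: y2; clear; lra.
  rewrite kS in sk.
  have : 0 < (S - n^-1) * (1 - 2 * (n^-1 + S)) by move: sk; rewrite !expr2; clear; lra.
  rewrite pmulr_lgt0 ?subr_gt0//.
  by move: s4 S4; clear; lra.
have phase_lt0 : cubic_phase w 1 < 0.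
  by rewrite /cubic_phase mulNr oppr_lt0 divr_gt0 ?exprn_gt0// !mulr_gt0.
(* The invariants agree, so the smaller modulus [1 / n] goes with the smaller absolute phase. *)
have phases : `|cubic_phase x y| < - cubic_phase w 1.
  rewrite -(ltr_pXn2r (n := 2)) ?nnegrE// ?oppr_ge0 ?ltW// real_normK ?num_real// sqrrN.
  have s2S : n^-1 ^+ 2 < S ^+ 2 by rewrite ltr_pXn2r ?nnegrE ?ltW.
  by move: kM kMw s2S; rewrite -/n; clear; lra.
move: phases; rewrite ltr_norml opprK => /andP[ph1 ph2].
have [||//|//|//|T arcT] := @center_arc R a b c d x0 x1 x y w (fun=> True) x_lt0 yx w3 kw.
- by rewrite ph1 ltW.
- move=> g tau sg gE.
  have /andP[yN yP] := y1.
  have e0 : 0 < Num.min (1 - y) (y + 1) by rewrite lt_min; move: yN yP; clear; lra.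
  have [r r0 Hr] := curve_near tau (solution_continuous sg) e0.
  exists r => // t /andP[taut tr]; have [|_] := Hr t.
    by rewrite gtr0_norm ?subr_gt0// ltrBlDl.
  rewrite gE /= lt_min => /andP[/ltr_normlP[e1 e2] /ltr_normlP[e3 e4]].
  by move: e1 e2 e3 e4; clear; lra.
- by exists T, w; split.
Qed.

(** The first alternative covers the points of the section themselves, as a forced arc has positive
    duration. *)
Definition reaches (R : realType) (F : R[i] -> set R[i]) (z : R[i]) : Prop :=
  exists2 x : R, Num.sqrt 3 < x &
    z = x +i* 1 \/ exists T, forced_arc F (fun=> True) z (x +i* 1) T.

Lemma reaches_trans (R : realType) (F : R[i] -> set R[i]) (Q : R[i] -> Prop)
    (z w : R[i]) (T : R) :
  forced_arc F Q z w T -> reaches F w -> reaches F z.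
Proof.
move=> /(forced_arcW (fun _ _ => I)) zw [x x3 [wE|[U arcU]]]; exists x => //; right.
  by exists T; rewrite -wE.
by exists (T + U); exact: forced_arc_trans zw arcU.
Qed.

Lemma reaches_lower_section (R : realType) (a b c d x0 x1 x : R) :
  0 < d -> Num.sqrt 3 < x0 -> Num.sqrt 3 < x ->
  reaches (system a b c d x0 x1) (- (x +i* 1)).
Proof.
move=> d0 x03 x3; have [T arcT] := @half_arc_lower R a b c d x0 x1 x d0 x03 x3.
by apply: reaches_trans arcT _; exists (half_map c d x0 x); [exact: half_map_gt|left].
Qed.

(** Reflecting an arc of the exchanged system leads [z] to the opposite section, and half a turn
    more leads to the section. *)
Lemma reaches_opp (R : realType) (a b c d x0 x1 : R) (z : R[i]) :
  0 < d -> Num.sqrt 3 < x0 ->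
  reaches (system c d a b x1 x0) (- z) -> reaches (system a b c d x0 x1) z.
Proof.
move=> d0 x03 [x x3 [zE|[T arcT]]].
  by rewrite -[z]opprK zE; exact: reaches_lower_section.
have sys_opp := @system_opp R c d a b x1 x0.
have sys_opp' := @system_opp R a b c d x0 x1.
have := forced_arc_opp sys_opp sys_opp' (fun _ _ => I : (fun=> True) _) arcT.
by rewrite opprK => /reaches_trans; apply; exact: reaches_lower_section.
Qed.

Lemma reaches_left (R : realType) (a b c d x0 x1 w : R) :
  0 < b -> 0 < d -> Num.sqrt 3 < x0 -> Num.sqrt 3 < x1 -> x1 < w ->
  reaches (system a b c d x0 x1) ((- w) +i* 1).
Proof.
move=> b0 d0 x03 x13 x1w; have w3 := lt_trans x13 x1w.
have [T arcT] := @left_arc R a b c d x0 x1 w b0 w3 x1w.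
by apply: reaches_trans arcT _; exact: reaches_lower_section.
Qed.

Lemma reaches_upper (R : realType) (a b c d x0 x1 : R) (z : R[i]) :
  0 < b -> 0 < d -> Num.sqrt 3 < x0 -> Num.sqrt 3 < x1 -> 1 < complex.Im z ->
  reaches (system a b c d x0 x1) z.
Proof.
case: z => x y /= b0 d0 x03 x13 y1.
have [rho [theta [rho0 /andP[theta0 thetapi] xE yE]]] :=
  @polar R (x + x1) (y - 1) (ltac:(by rewrite subr_gt0)).
have zE : x +i* y = (rho * cos theta - x1) +i* (1 + rho * sin theta).
  by rewrite -xE -yE addrK addrCA subrr addr0.
have thetaP : 0 <= theta < pi by rewrite ltW.
have cross : theta = 0 -> Num.sqrt 3 < rho - x1.
  by move=> t0; rewrite t0 ltxx in theta0.
have harc := @spiral_arc R a b c d x0 x1 rho theta (fun=> True) b0 rho0 thetaP cross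
  I I (fun _ _ => I).
rewrite zE; apply: (reaches_trans harc).
by apply: reaches_left => //; rewrite ltrDl mulr_gt0// expR_gt0.
Qed.

(** By [good_opp] and [reaches_opp] only the first and third clauses of [good] need work. A point
    above the line follows a spiral; on the line it belongs to the section or crosses downwards; in
    the strip it follows a central arc, reflected when [x > 0]. *)
Lemma good_reaches (R : realType) (a b c d x0 x1 : R) (z : R[i]) :
  0 < b -> 0 < d -> Num.sqrt 3 < x0 -> Num.sqrt 3 < x1 ->
  good x0 x1 z -> reaches (system a b c d x0 x1) z.
Proof.
have center (a' b' c' d' x0' x1' x y : R) : 0 < d' -> Num.sqrt 3 < x0' ->
    -1 < y < 1 -> x < 0 -> outer x y -> reaches (system a' b' c' d' x0' x1') (x +i* y).
  move=> d0 x03 y1 xlt0 oxy.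
  have [T [w [w3 arcT]]] := @outer_center_arc R a' b' c' d' x0' x1' x y y1 xlt0 oxy.
  by apply: reaches_trans arcT _; exact: reaches_lower_section.
have half (a' b' c' d' x0' x1' : R) (w : R[i]) : 0 < b' -> 0 < d' ->
    Num.sqrt 3 < x0' -> Num.sqrt 3 < x1' ->
    1 < complex.Im w \/ [/\ outer (complex.Re w) (complex.Im w), -1 < complex.Im w &
     [\/ complex.Im w < 1, Num.sqrt 3 < complex.Re w | complex.Re w < - x1']] ->
    reaches (system a' b' c' d' x0' x1') w.
  case: w => x y /= b0 d0 x03 x13 [y1|[oxy yN H]]; first exact: reaches_upper.
  have [y1|y1|yE] := ltgtP y 1; last 2 first.
  - exact: reaches_upper.
  - rewrite yE; case: H => H; first by rewrite yE ltxx in H.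
      by exists x => //; left.
    by rewrite -[x]opprK; apply: reaches_left => //; rewrite ltrNr.
  have [xlt0|x_gt0|xE] := ltgtP x 0.
  - by apply: center => //; rewrite yN.
  - apply: reaches_opp => //.
    rewrite (_ : - (x +i* y) = (- x) +i* (- y)); last by [].
    apply: center => //; [by rewrite ltrN2 y1 ltrNl|by rewrite oppr_lt0|].
    exact/outerNl/outerNr.
  (* The imaginary axis is excluded: there [outer] would force [y ^ 2 > 4]. *)
  - case: oxy; rewrite xE expr0n/= add0r => y4 _.
    have : y ^+ 2 < 1.
      rewrite -(expr1n _ 2) -real_normK ?num_real// ltr_pXn2r ?nnegrE//.
      by rewrite ltr_norml yN.
    by move: y4; clear; lra.
move=> b0 d0 x03 x13 gz.
have gz' := good_opp gz.
case: gz => H.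
- by apply: half => //; left.
- apply: reaches_opp => //; apply: half => //; left.
  by case: z H {gz'} => x y /= H; rewrite ltrNr.
- by apply: half => //; right.
- apply: reaches_opp => //; apply: half => //; right.
  case: z H {gz'} => x y /= [oxy y1 H]; split; [exact/outerNl/outerNr|by rewrite ltrN2|].
  case: H => H; [apply: Or31|apply: Or32|apply: Or33].
  + by rewrite ltrNl.
  + by rewrite ltrNr.
  + by rewrite ltrN2.
Qed.

(** Every clause of [good] consists of strict inequalities between continuous functions; the last
    two clauses extend across the lines along the crossing parts. *)
Lemma good_nbhs (R : realType) (x0 x1 : R) (x y : R) : good x0 x1 (x +i* y) ->
  \forall p \near ((x, y) : R * R), good x0 x1 (p.1 +i* p.2).
Proof.
have c1 : (fun p : R * R => p.1) p @[p --> (x, y)] --> x by exact: cvg_fst.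
have c2 : (fun p : R * R => p.2) p @[p --> (x, y)] --> y by exact: cvg_snd.
have near_gt (f : R * R -> R) (l k : R) : f p @[p --> (x, y)] --> l -> k < l ->
    \forall p \near ((x, y) : R * R), k < f p.
  by move=> fl kl; exact: (cvgr_gt _ fl).
have near_lt (f : R * R -> R) (l k : R) : f p @[p --> (x, y)] --> l -> l < k ->
    \forall p \near ((x, y) : R * R), f p < k.
  by move=> fl kl; exact: (cvgr_lt _ fl).
have near_outer : outer x y -> \forall p \near ((x, y) : R * R), outer p.1 p.2.
  have c11 : p.1 ^+ 2 @[p --> (x, y)] --> x ^+ 2 by apply: (cvgM c1 c1).
  have c22 : p.2 ^+ 2 @[p --> (x, y)] --> y ^+ 2 by apply: (cvgM c2 c2).
  have cD : (p.1 ^+ 2 + p.2 ^+ 2) @[p --> (x, y)] --> x ^+ 2 + y ^+ 2 by apply: (cvgD c11 c22).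
  have cB : (p.1 ^+ 2 - p.2 ^+ 2) @[p --> (x, y)] --> x ^+ 2 - y ^+ 2 by apply: (cvgB c11 c22).
  have c8 : (8 * (p.1 ^+ 2 - p.2 ^+ 2)) @[p --> (x, y)] --> 8 * (x ^+ 2 - y ^+ 2).
    apply: (cvgM (cvg_cst _) cB).
  have cD2 : ((p.1 ^+ 2 + p.2 ^+ 2) ^+ 2) @[p --> (x, y)] --> (x ^+ 2 + y ^+ 2) ^+ 2.
    apply: (cvgM cD cD).
  have cF : ((p.1 ^+ 2 + p.2 ^+ 2) ^+ 2 - 8 * (p.1 ^+ 2 - p.2 ^+ 2)) @[p --> (x, y)] -->
      (x ^+ 2 + y ^+ 2) ^+ 2 - 8 * (x ^+ 2 - y ^+ 2) by apply: (cvgB cD2 c8).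
  move=> [n4 inv8]; near=> p; split.
    by near: p; exact: near_gt cD n4.
  rewrite -subr_gt0; near: p; apply: near_gt cF _.
  by rewrite subr_gt0.
rewrite /good /=; case=> [y1|y1|[oxy y1 H]|[oxy y1 H]].
- by near=> p; apply: Or41; near: p; exact: near_gt c2 y1.
- by near=> p; apply: Or42; near: p; exact: near_lt c2 y1.
- near=> p; apply: Or43; split.
  + by near: p; exact: near_outer.
  + by near: p; exact: near_gt c2 y1.
  + near: p; case: H => H; near=> p.
    * by apply: Or31; near: p; exact: near_lt c2 H.
    * by apply: Or32; near: p; exact: near_gt c1 H.
    * by apply: Or33; near: p; exact: near_lt c1 H.
- near=> p; apply: Or44; split.
  + by near: p; exact: near_outer.
  + by near: p; exact: near_lt c2 y1.
  + near: p; case: H => H; near=> p.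
    * by apply: Or31; near: p; exact: near_gt c2 H.
    * by apply: Or32; near: p; exact: near_lt c1 H.
    * by apply: Or33; near: p; exact: near_gt c1 H.
Unshelve. all: by end_near. Qed.

(** Compactness of [[0, T]] turns the openness of [good] into a single radius, as the uniform
    neighbourhood in [limit_cycle] demands. *)
Lemma good_near_curve (R : realType) (x0 x1 T : R) (g : R -> R[i]) :
  continuous_curve g -> (forall t, good x0 x1 (g t)) ->
  exists2 e : R, 0 < e & forall t w, 0 <= t <= T ->
    `|complex.Re w - complex.Re (g t)| < e ->
    `|complex.Im w - complex.Im (g t)| < e -> good x0 x1 w.
Proof.
move=> cg gg.
pose P e t := forall w, `|complex.Re w - complex.Re (g t)| < e ->
    `|complex.Im w - complex.Im (g t)| < e -> good x0 x1 w.
have /compact_near_coveringP cov := @segment_compact R 0 T.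
have : \forall e \near 0^'+, `[0, T]%classic `<=` P e.
  apply: cov => t _.
  have gt : good x0 x1 (complex.Re (g t) +i* complex.Im (g t)).
    by have := gg t; case: (g t).
  have [d /= d0 Hd] : exists2 d : R, 0 < d & forall p : R * R,
      `|p.1 - complex.Re (g t)| < d -> `|p.2 - complex.Im (g t)| < d ->
      good x0 x1 (p.1 +i* p.2).
    have [[A B] /= [[d1 /= d10 A1] [d2 /= d20 B2]] AB] := good_nbhs gt.
    exists (Num.min d1 d2); first by rewrite lt_min d10.
    move=> p; rewrite !lt_min => /andP[p1 _] /andP[_ p2].
    apply: AB; split; [apply: A1|apply: B2]; by rewrite /ball/= distrC.
  (* One half of [d] pays for the distance from [w] to [g s], the other for that from [g s] to
     [g t]. *)
  have d20 : 0 < d / 2 by rewrite divr_gt0.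
  have [r r0 Hr] := curve_near t cg d20.
  exists ([set s | `|s - t| < r], [set e | e < d / 2]).
    split=> /=.
      by exists r => // s /=; rewrite distrC.
    exact: nbhs_right_lt.
  move=> [s e] /= [/Hr[sR sI] ed] w wR wI.
  have -> : w = complex.Re w +i* complex.Im w by case: w {wR wI}.
  apply: (Hd (complex.Re w, complex.Im w)) => /=.
    move: sR wR ed; move: (complex.Re w) (complex.Re (g s)) (complex.Re (g t)).
    clear=> p q u pq qu ed; have := ler_normD (p - q) (q - u).
    by rewrite addrA subrK; move: pq qu ed; clear; lra.
  move: sI wI ed; move: (complex.Im w) (complex.Im (g s)) (complex.Im (g t)).
  clear=> p q u pq qu ed; have := ler_normD (p - q) (q - u).
  by rewrite addrA subrK; move: pq qu ed; clear; lra.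
move=> He; have [e [Pe e0]] := filter_ex (filterI He (nbhs_right_gt 0)).
by exists e => // t w tT; apply: Pe; rewrite /= in_itv.
Qed.

Lemma normc_ge_Im (R : realType) (z : R[i]) : `|complex.Im z|%:C <= `|z|.
Proof.
case: z => x y; rewrite normc_def lecR /= -sqrtr_sqr ler_wsqrtr//.
by rewrite lerDr sqr_ge0.
Qed.

Lemma normc_lt_ReIm (R : realType) (z : R[i]) (e : R) : `|z| < e%:C ->
  `|complex.Re z| < e /\ `|complex.Im z| < e.
Proof.
move=> ze; rewrite -!ltcR; split.
  exact: le_lt_trans (normc_ge_Re z) ze.
exact: le_lt_trans (normc_ge_Im z) ze.
Qed.

(** * The limit cycle *)

Lemma periodic_in_segment (R : realType) (V : Type) (g : R -> V) (T t : R) :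
  0 < T -> (forall t, g (t + T) = g t) -> exists2 u, 0 <= u <= T & g u = g t.
Proof.
move=> T0 gT.
have : range g (g t) by exists t.
rewrite (periodic_range 0 T0 gT) => -[s /= s0]; rewrite add0r => <-.
pose n := Num.trunc (s / T); exists (s - n%:R * T); last first.
  by rewrite -(periodic_add_mul (s - n%:R * T) n gT) subrK.
have /andP[nt tn] : n%:R <= s / T < n.+1%:R by apply: truncn_itv; rewrite divr_ge0// ltW.
rewrite ler_pdivlMr// in nt; rewrite ltr_pdivrMr// -natr1 mulrDl mul1r in tn.
by move: nt tn; clear; lra.
Qed.

(** The distance from the orbit to [p] attains its minimum over one period, and the points [z n],
    which approach [p] geometrically, force this minimum to be 0. *)
Lemma periodic_range_limit (R : realType) (g : R -> R[i]) (T C r : R) (z : nat -> R[i])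
    (p : R[i]) :
  0 < T -> (forall t, g (t + T) = g t) -> continuous_curve g -> `|r| < 1 ->
  (forall n, range g (z n)) ->
  (forall n, `|complex.Re (z n) - complex.Re p| + `|complex.Im (z n) - complex.Im p| <=
             C * r ^+ n) ->
  range g p.
Proof.
move=> T0 gT cg r1 gz zC.
pose dist t := `|complex.Re (g t) - complex.Re p| + `|complex.Im (g t) - complex.Im p|.
have cdist : {within `[0, T], continuous dist}.
  apply: continuous_subspaceT => s.
  apply: (@continuousD _ _ _ (fun t => `|complex.Re (g t) - complex.Re p|)
    (fun t => `|complex.Im (g t) - complex.Im p|)).
    by apply: (@continuous_dist _ _ (fun=> _)); [exact: cg.1|exact: cst_continuous].
  by apply: (@continuous_dist _ _ (fun=> _)); [exact: cg.2|exact: cst_continuous].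
have [c _ cmin] := EVT_min (ltW T0) cdist.
have dist0 : dist c = 0.
  apply/eqP; rewrite eq_le addr_ge0// andbT leNgt; apply/negP => dc0.
  have C0 : 0 < `|C| + 1 by rewrite ltr_wpDl.
  have e0 : 0 < dist c / (`|C| + 1) by rewrite divr_gt0.
  have [n /= rn] := filter_ex (cvgr0_norm_lt _ (cvg_expr r1) _ e0).
  rewrite ltr_pdivlMr// in rn.
  have [t _ gt] := gz n; have [u uT gu] := periodic_in_segment t T0 gT.
  have := cmin u; rewrite in_itv/= => /(_ uT); rewrite /dist gu gt.
  rewrite leNgt => /negP; apply; apply: le_lt_trans (zC n) _.
  apply: le_lt_trans rn; apply: (le_trans (ler_norm _)); rewrite normrM mulrC.
  by rewrite ler_wpM2l// lerDl.
exists c => //.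
have /andP[] : (`|complex.Re (g c) - complex.Re p| == 0) &&
    (`|complex.Im (g c) - complex.Im p| == 0).
  by rewrite -paddr_eq0// [X in X == 0]dist0.
by rewrite !normr_eq0 !subr_eq0 => /eqP ? /eqP ?; exact: complexP.
Qed.

Theorem proposition3 (R : realType) (a b c d x0 x1 : R)
    (ha : a < 0) (hc : c < 0) (hb : 0 < b) (hd : 0 < d)
    (hx0 : Num.sqrt 3 < x0) (hx1 : Num.sqrt 3 < x1) :
  exists G : set R[i],
    limit_cycle
      (filippov_strip
        (fun z : R[i] => (a +i* b) * (z - 'i%C + x1%:C))
        (fun z : R[i] => 'i%C * z ^+ 3)
        (fun z : R[i] => (c +i* d) * (z + 'i%C - x0%:C))) G.
Proof.
pose F := system a b c d x0 x1.
pose P x := half_map c d x0 (half_map a b x1 x).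
pose r := expR (a * (pi / b)) * expR (c * (pi / d)).
have decay l m : l < 0 -> 0 < m -> expR (l * (pi / m)) < 1 :> R.
  by move=> l0 m0; rewrite expR_lt1 nmulr_rlt0// divr_gt0// pi_gt0.
have r0 : 0 < r by rewrite mulr_gt0// expR_gt0.
have r1 : r < 1.
  apply: lt_trans (decay _ _ hc hd); rewrite gtr_pMl ?expR_gt0//; exact: decay.
have PE x y : P x - P y = r * (x - y) by rewrite /P /half_map /r; ring.
have P3 x : Num.sqrt 3 < x -> Num.sqrt 3 < P x.
  by move=> x3; exact: half_map_gt hx0 (half_map_gt a b hx1 x3).
(* [P] is affine with slope [r], so this is its fixed point. *)
pose xs := P 0 / (1 - r).
have r1' : 0 < 1 - r by rewrite subr_gt0.
have Pxs : P xs = xs.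
  apply/eqP; rewrite -subr_eq0; apply/eqP.
  have -> : P xs - xs = (P xs - P 0) + P 0 - xs by rewrite subrK.
  by rewrite PE subr0 /xs; field; rewrite gt_eqF.
have [x0_gt0 _] := sqrt3_lt hx0; have [x1_gt0 _] := sqrt3_lt hx1.
have xs3 : Num.sqrt 3 < xs.
  (* As [0 < 1 - r < 1] and [P 0 > 0], [xs > P 0 > x0 > sqrt 3]. *)
  have P0 : x0 < P 0.
    rewrite /P /half_map add0r ltrDl mulr_gt0 ?expR_gt0//.
    by rewrite addr_gt0// addr_gt0// mulr_gt0// expR_gt0.
  apply: (lt_trans hx0); rewrite /xs ltr_pdivlMr//; apply: lt_trans P0.
  by rewrite gtr_pMr// gtrBl.
have [T cycle] := @return_arc R a b c d x0 x1 xs hb hd hx0 hx1 xs3.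
rewrite -/F -[half_map c d x0 _]/(P xs) Pxs in cycle.
have T0 : 0 < T by case: cycle.
have [g [solg gT g0 good_g]] := forced_arc_periodic cycle.
exists (range g); split.
  exists g; split=> //; first by exists T.
  (* The cycle is not a single point: half a turn later the real part is negative. *)
  have [U [U0 [h [h0 hU _ _ hu]]]] := @half_arc R a b c d x0 x1 xs hb hx1 xs3.
  have gU : g (0 + U) = h U by apply: hu => //; rewrite lexx ltW.
  exists 0, (0 + U); rewrite gU hU g0.
  have xs_gt0 : 0 < xs by case: (sqrt3_lt xs3).
  apply/negP => /eqP/(congr1 (@complex.Re R))/= E.
  have : 0 < x1 + (xs + x1) * expR (a * (pi / b)).
    by rewrite addr_gt0// mulr_gt0 ?expR_gt0// addr_gt0.
  by move: E xs_gt0; clear; lra.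
(* This radius keeps every point near the cycle in [good], so that a competing orbit through it is
   forced to the section. *)
have [e e0 He] := @good_near_curve R x0 x1 T g (solution_continuous solg) good_g.
exists e => // G' [g' [solg' [T' T'0 g'T'] _ ->]] [z [w [[t _ <-] [tau _ g'tau] wz]]].
have [u uT gu] := periodic_in_segment t T0 gT.
have good_w : good x0 x1 w.
  have [wR wI] := normc_lt_ReIm wz.
  apply: (He u w uT); rewrite gu; move: wR wI; case: (w) (g t) => [? ?] [? ?] /=; by [].
have [x x3 xw] : reaches F w by exact: good_reaches.
have sect : range g' (x +i* 1).
  case: xw => [<-|[U [U0 [h [h0 hU _ _ hu]]]]]; first by exists tau.
  by exists (tau + U) => //; rewrite (hu g' tau solg' g'tau U) ?lexx ?ltW.
have iter3 n : Num.sqrt 3 < iter n P x by elim: n => //= n; exact: P3.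
have orbit n : range g' (iter n P x +i* 1).
  elim: n => //= n [s _ g's].
  have [U [U0 [h [h0 hU _ _ hu]]]] := @return_arc R a b c d x0 x1 _ hb hd hx0 hx1 (iter3 n).
  by exists (s + U) => //; rewrite (hu g' s solg' g's U) ?lexx ?ltW.
have [s _ g's] : range g' (xs +i* 1).
  (* The iterates approach [xs] at the exact rate [r ^ n], from the initial distance [|x - xs|]. *)
  apply: (@periodic_range_limit R g' T' `|x - xs| r (fun n => iter n P x +i* 1)) => //.
  - exact: solution_continuous solg'.
  - by rewrite ger0_norm ?ltW.
  - move=> n /=; rewrite subrr normr0 addr0.
    elim: n => [|n IH] /=; first by rewrite expr0 mulr1.
    rewrite -[X in _ - X]Pxs PE normrM (gtr0_norm r0) exprS mulrCA.
    by rewrite ler_pM2l.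
exact: (forced_arc_range cycle solg' solg T'0 T0 g'T' gT g's g0).
Qed.
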